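(* Assume $\mathbb E[\tanh(h)]=0$, $\theta_1=\frac{1}{\mathbb E[\operatorname{sech}^2(h)]}$, that $0$ is a global minimum of $H(x)=\frac12x^2-\mathbb E[\log\cosh(\sqrt{\theta_1}x+h)]$ with flatness $\tau$, and $k=o\left(n^{\frac{4\tau-2}{8\tau-5}}\right)$. For every $\delta>0$ there is a constant $C>0$ such that, if the samples are drawn from $\mathbb P_S$ with hidden clique $S\subset[n]$, $|S|=k$, and $m\ge Ck^{\frac{1}{2\tau-1}}\log n$, then any $$S_{\max}\in\operatorname*{arg\,max}_{S':|S'|=k}\phi_{S'},\qquad \phi_{S'}=k^{-\frac{4\tau-3}{2\tau-1}}\,\mathbb 1_{S'}^\top\Big(\frac1m\sum_{j=1}^m\boldsymbol\sigma^{(j)}\boldsymbol\sigma^{(j)\top}\Big)\mathbb 1_{S'},$$ satisfies $\mathbb P\left(|S\Delta S_{\max}|\ge\delta k\right)=o(1)$.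
   Context: Planted random field Curie-Weiss (pRFCW) model. Let $\mu$ be a probability measure on $\mathbb R$ with $\int|h|\,d\mu<\infty$, $h\sim\mu$, $\theta_1>0$, $[n]=\{1,\dots,n\}$, and $h_1,\dots,h_n$ i.i.d. $\sim\mu$, $\boldsymbol h=(h_1,\dots,h_n)$. For $S\subset[n]$ with $|S|=k$ define, for $\boldsymbol\sigma\in\{-1,+1\}^n$, $$\mathbb P_S(\boldsymbol\sigma\mid\boldsymbol h)\propto\exp\Big(\frac{\theta_1}{2k}\sum_{i,j\in S}\sigma_i\sigma_j+\sum_{i=1}^n h_i\sigma_i\Big)$$ (normalized) and $\mathbb P_S(\boldsymbol\sigma)=\mathbb E_{\boldsymbol h}[\mathbb P_S(\boldsymbol\sigma\mid\boldsymbol h)]$. One observes $m$ i.i.d. samples $\boldsymbol\sigma^{(1)},\dots,\boldsymbol\sigma^{(m)}$ from $\mathbb P_S$ (each with its own independent field). $\mathbb 1_{S'}\in\{0,1\}^n$ is the indicator vector, $\Delta$ the symmetric difference. Asymptotics: $k\to\infty$ with $n=n(k)\ge k$, $m=m(k)$; $\mu,\theta_1$ fixed. Flatness: a local minimum $x^*$ of $H$ is $\tau$-flat ($\tau\in\mathbb N$, $\tau\ge2$) if $H(x)=H(x^* )+\frac{H^{(2\tau)}(x^* )}{(2\tau)!}(x-x^* )^{2\tau}+O((x-x^* )^{2\tau+1})$ as $x\to x^*$ with $H^{(2\tau)}(x^* )>0$.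
   Formalization: The formal theorem additionally assumes that the field h is not almost surely 0 (μ ≠ δ_0); for μ = δ_0, θ_1 = 1, τ = 2, n = k² the claim fails by Fano's inequality, since m of order k^{1/3} log n samples carry too little information. *)

(* Defs.v *)
From HB Require Import structures.
From mathcomp Require Import all_boot all_order all_algebra.
From mathcomp Require Import all_classical all_reals all_analysis.

Set Implicit Arguments.
Unset Strict Implicit.
Unset Printing Implicit Defensive.

Import Order.TTheory GRing.Theory Num.Theory.
Import numFieldNormedType.Exports.

Local Open Scope classical_set_scope.
Local Open Scope ring_scope.

Section hyperbolic.
Context {R : realType}.
Implicit Type x : R.

Definition cosh x : R := (expR x + expR (- x)) / 2.
Definition sinh x : R := (expR x - expR (- x)) / 2.
Definition tanh x : R := sinh x / cosh x.
Definition sech x : R := (cosh x)^-1.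

End hyperbolic.

Section iid_law.
Context d (T : measurableType d) (R : realType).

Definition tuple_cons n (x : T * n.-tuple T) : n.+1.-tuple T :=
  [tuple of x.1 :: x.2].

Lemma measurable_tuple_cons n : measurable_fun setT (@tuple_cons n).
Proof. exact: measurable_cons. Qed.

HB.instance Definition _ n :=
  isMeasurableFun.Build _ _ _ _ (@tuple_cons n) (@measurable_tuple_cons n).

(* The n-fold product measure mu ^ n, built as the law of (h_1, (h_2 .. h_n))
   under mu \x mu ^ (n - 1); mathcomp-analysis only has binary products. *)
Fixpoint iid_law (mu : probability T R) n : probability (n.-tuple T) R :=
  match n return probability (n.-tuple T) R with
  | 0 => \d_([tuple] : 0.-tuple T)
  | n'.+1 => distribution (mu \x iid_law mu n')%E (@tuple_cons n')
  end.

End iid_law.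

(* true encodes the spin +1 and false the spin -1. *)
Definition spins n := {ffun 'I_n -> bool}.

Definition spin {R : realType} n (s : spins n) (i : 'I_n) : R :=
  if s i then 1 else -1.

Section planted_model.
Context {R : realType} (mu : probability (measurableTypeR R) R) (theta1 : R).

Definition gibbs_weight n (S : {set 'I_n}) (h : n.-tuple R) (s : spins n) : R :=
  expR (theta1 / (2 * #|S|%:R) *
          (\sum_(i in S) \sum_(j in S) spin s i * spin s j)
        + \sum_(i < n) tnth h i * spin s i).

Definition planted_pmf_cond n (S : {set 'I_n}) (h : n.-tuple R) (s : spins n)
    : R :=
  gibbs_weight S h s / \sum_(s' : spins n) gibbs_weight S h s'.

Definition planted_pmf n (S : {set 'I_n}) (s : spins n) : R :=
  fine ('E_(iid_law mu n)[fun h => planted_pmf_cond S h s])%E.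

Definition samples n m := {ffun 'I_m -> spins n}.

(* Probability of the event E under the law of m i.i.d. samples from the
   planted model, i.e. under the m-fold product of planted_pmf. *)
Definition sample_prob n m (S : {set 'I_n}) (E : pred (samples n m)) : R :=
  \sum_(s : samples n m | E s) \prod_(j < m) planted_pmf S (s j).

Definition potential (x : R) : R :=
  x ^+ 2 / 2
  - fine ('E_mu[fun h : R => ln (cosh (Num.sqrt theta1 * x + h))])%E.

End planted_model.

Definition local_minimum {R : realType} (H : R -> R) (x0 : R) : Prop :=
  \forall x \near x0, H x0 <= H x.

Definition flat_minimum {R : realType} (H : R -> R) (x0 : R) (tau : nat)
    : Prop :=
  [/\ (2 <= tau)%N,
      local_minimum H x0,
      0 < derive1n (2 * tau) H x0 &
      (fun x => H x - (H x0 + derive1n (2 * tau) H x0 / ((2 * tau)`!)%:R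
                               * (x - x0) ^+ (2 * tau)))
        =O_ (nbhs x0) (fun x => (x - x0) ^+ (2 * tau).+1)].

Section statistic.
Context {R : realType}.

Definition spin_col n (s : spins n) : 'cV[R]_n := \col_i spin s i.

Definition indic_col n (S : {set 'I_n}) : 'cV[R]_n := \col_i (i \in S)%:R.

Definition second_moment_mx n m (s : samples n m) : 'M[R]_n :=
  m%:R^-1 *: \sum_(j < m) (spin_col (s j) *m (spin_col (s j))^T).

(* The 1 x 1 matrix indic^T M indic is read off at its unique entry. *)
Definition phi (tau k n m : nat) (s : samples n m) (S' : {set 'I_n}) : R :=
  k%:R `^ (- ((4 * tau%:R - 3) / (2 * tau%:R - 1)))
  * ((indic_col S')^T *m second_moment_mx s *m indic_col S') 0 0.

Definition phi_argmax (tau k n m : nat) (s : samples n m) (S0 : {set 'I_n})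
    : Prop :=
  #|S0| = k /\
  forall S' : {set 'I_n}, #|S'| = k -> phi tau k s S' <= phi tau k s S0.

End statistic.

Definition symdiff n (A B : {set 'I_n}) : {set 'I_n} :=
  (A :\: B) :|: (B :\: A).

(* Main.v *)
Require Import Defs.
From mathcomp Require Import all_boot all_order all_fingroup all_algebra.
From mathcomp Require Import all_classical all_reals all_analysis.
From mathcomp Require Import measurable_realfun.
From mathcomp Require Import ring lra zify.

Set Implicit Arguments.
Unset Strict Implicit.
Unset Printing Implicit Defensive.

Import Order.TTheory GRing.Theory Num.Theory.
Import numFieldNormedType.Exports.

Local Open Scope classical_set_scope.
Local Open Scope ring_scope.

(** Each spin outside the clique [S] is a fair coin independent of the rest,
    because [tanh h] has mean zero, and the spins of [S] are exchangeable, because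
    the field is i.i.d. ([planted_pmf_flip], [planted_pmf_permute]). So the
    planted law only depends on the number of plus spins in [S]
    ([planted_pmf_plus_count]), and it is bounded, up to a factor [#|S| + 1], by
    the product law with the matching density ([planted_pmf_le_product_law]).

    Write [B_S] for the sum of the spins of a sample over [S], [k] for [#|S|], and
    [g = 1 / (2 tau - 1)]. The statistic of a competitor [S'] is proportional to
    the sum over the samples of [B_S' ^ 2]. With [a = #|S :&: S'| / k] and
    [W = B_S' - a B_S], the coefficients of [W] add up to zero on [S], so that [W]
    is sub-Gaussian of variance of order [k], up to polynomial factors
    ([planted_square_mgf]). A competitor far from [S] has [a <= 1 - delta / 2],
    and can beat [S] only if the sum of [W ^ 2] is at least a constant times the
    sum of [B_S ^ 2] ([overlap_fluctuation_ge]). By Chernoff bounds over the [m]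
    samples and a union bound over the at most [n ^ k] competitors
    ([sample_prob_symdiff_le], [union_bound_le_harmonic]), this is unlikely as soon
    as [m k^(1 - g)] is a large multiple of [k ln n], provided that [B_S ^ 2] is at
    least of order [k^(2 - g)] with probability bounded below.

    This last point is where criticality enters
    ([planted_magnetization_laplace], [magnetization_laplace_scale]). For a fixed
    field [h], the weight [theta1 B_S^2 / (2 k)] is the maximum over [x] of
    [sqrt theta1 x B_S - k x^2 / 2], attained at [x = sqrt theta1 B_S / k]; the
    inequality bounds the partition function from below at any [x], and the
    equality bounds from above the weight of each value of [B_S]
    ([partition_ge], [partition_class_le]). Both bounds have the exponent
    [- k (H x - H 0) + sqrt theta1 x A] with [A] the sum of the [tanh h_i] over
    [S], up to fluctuations of lower order ([tilted_energyE]). As [A] is of order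
    [sqrt k] and [H x - H 0] is nonnegative and at most of order [x^(2 tau)], the
    two terms balance at [|x|] of order [k^(- g / 2)], where they are of order
    [k^((1 - g) / 2)], a positive power of [k]: the values of [B_S] which are
    small compared with [k^(1 - g / 2)] have negligible weight. That [A] is of
    order [sqrt k] with positive probability follows from its second and fourth
    moments. *)

(** * Exponential inequalities and hyperbolic functions *)

Section exponential_inequalities.
Context {R : realType}.
Implicit Types x y u p h : R.

(** For [y <= 1/2] this is [expR (- y) >= 1 - y] together with
    [(1 + 2 y^2 + y) (1 - y) >= 1]; beyond, [y <= 2 y^2]. *)
Lemma expR_le_addr_sqr y : expR y <= y + expR (2 * y ^+ 2).
Proof.
have [yle|ygt] := leP y 2^-1.
  have h1 : 1 + 2 * y ^+ 2 <= expR (2 * y ^+ 2) by exact: expR_ge1Dx.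
  have h2 : 1 - y <= expR (- y) by exact: expR_ge1Dx.
  suff : expR y <= 1 + y + 2 * y ^+ 2 by lra.
  have h3 : expR y * (1 - y) <= 1.
    by rewrite -[leRHS](expRxMexpNx_1 y) ler_pM2l ?expR_gt0.
  have h4 : 1 <= (1 + y + 2 * y ^+ 2) * (1 - y).
    have -> : (1 + y + 2 * y ^+ 2) * (1 - y) = 1 + y ^+ 2 * (1 - 2 * y) by ring.
    by rewrite lerDl mulr_ge0 ?sqr_ge0//; lra.
  have h5 : 0 < 1 - y by lra.
  by rewrite -(ler_pM2r h5); exact: le_trans h3 h4.
have h1 : expR y <= expR (2 * y ^+ 2) by rewrite ler_expR; nra.
by lra.
Qed.

Lemma two_point_mgf_ge1 p u :
  0 <= p <= 1 ->
  1 <= p * expR (u * (1 - (2 * p - 1))) + (1 - p) * expR (u * (- 1 - (2 * p - 1))).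
Proof.
move=> /andP[p0 p1].
have h1 := expR_ge1Dx (u * (1 - (2 * p - 1))).
have h2 := expR_ge1Dx (u * (- 1 - (2 * p - 1))).
have h3 : p * (1 + u * (1 - (2 * p - 1))) <= p * expR (u * (1 - (2 * p - 1))).
  exact: ler_wpM2l.
have h4 : (1 - p) * (1 + u * (- 1 - (2 * p - 1)))
          <= (1 - p) * expR (u * (- 1 - (2 * p - 1))).
  by apply: ler_wpM2l => //; lra.
apply: le_trans (lerD h3 h4).
by rewrite le_eqVlt; apply/orP; left; apply/eqP; ring.
Qed.

(** A spin with mean [2 p - 1], once centred, has values of size at most 2;
    [expR_le_addr_sqr] then loses the linear term. *)
Lemma two_point_mgf_le p u : 0 <= p <= 1 ->
  p * expR (u * (1 - (2 * p - 1))) + (1 - p) * expR (u * (- 1 - (2 * p - 1)))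
  <= expR (8 * u ^+ 2).
Proof.
move=> /andP[p0 p1].
set a := u * (1 - (2 * p - 1)); set b := u * (- 1 - (2 * p - 1)).
have ha := expR_le_addr_sqr a; have hb := expR_le_addr_sqr b.
have ka : expR (2 * a ^+ 2) <= expR (8 * u ^+ 2).
  rewrite ler_expR /a exprMn mulrCA (mulrC 8) ler_wpM2l ?sqr_ge0//; nra.
have kb : expR (2 * b ^+ 2) <= expR (8 * u ^+ 2).
  rewrite ler_expR /b exprMn mulrCA (mulrC 8) ler_wpM2l ?sqr_ge0//; nra.
have h1 : p * expR a <= p * (a + expR (8 * u ^+ 2)).
  by rewrite ler_wpM2l// (le_trans ha)// lerD2l.
have h2 : (1 - p) * expR b <= (1 - p) * (b + expR (8 * u ^+ 2)).
  by rewrite ler_wpM2l ?(le_trans hb) ?lerD2l//; lra.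
apply: le_trans (lerD h1 h2) _.
by rewrite le_eqVlt; apply/orP; left; apply/eqP; rewrite /a /b; ring.
Qed.

Lemma cosh_gt0 x : 0 < cosh x.
Proof. by rewrite divr_gt0// addr_gt0// expR_gt0. Qed.

Lemma cosh_ge1 x : 1 <= cosh x.
Proof. by have := expR_ge1Dx x; have := expR_ge1Dx (- x); rewrite /cosh; lra. Qed.

Lemma abs_tanh_le1 x : `|tanh x| <= 1.
Proof.
rewrite /tanh normrM normfV (gtr0_norm (cosh_gt0 x)) ler_pdivrMr ?cosh_gt0//.
rewrite mul1r ler_norml /sinh /cosh.
by have := expR_gt0 x; have := expR_gt0 (- x); move=> ? ?; apply/andP; split; lra.
Qed.

Lemma cosh_shift u h : let p := expR h / (2 * cosh h) in
  cosh (u + h) / cosh h = expR (u * tanh h)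
    * (p * expR (u * (1 - (2 * p - 1))) + (1 - p) * expR (u * (- 1 - (2 * p - 1)))).
Proof.
move=> p.
have c0 : expR h + expR (- h) != 0 by rewrite gt_eqF// addr_gt0// expR_gt0.
have tp : tanh h = 2 * p - 1 by rewrite /p /tanh /sinh /cosh; field; rewrite c0.
have e1 : expR (u * tanh h) * expR (u * (1 - (2 * p - 1))) = expR u.
  by rewrite tp -expRD; congr expR; ring.
have e2 : expR (u * tanh h) * expR (u * (- 1 - (2 * p - 1))) = expR (- u).
  by rewrite tp -expRD; congr expR; ring.
rewrite mulrDr mulrCA e1 (mulrCA _ (1 - p)) e2 /p /cosh opprD !expRD.
by field; rewrite c0.
Qed.

(** A spin in the field [h] is a two-point variable with mean [tanh h], and
    [cosh (u + h) / cosh h] is its moment generating function. *)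
Lemma lncosh_shift_bounds u h :
  0 <= ln (cosh (u + h)) - ln (cosh h) - u * tanh h <= 8 * u ^+ 2.
Proof.
pose p := expR h / (2 * cosh h).
have p01 : 0 <= p <= 1.
  have h1 := expR_gt0 h; have h2 := expR_gt0 (- h).
  have h3 : 0 < 2 * cosh h by rewrite mulr_gt0 ?cosh_gt0.
  apply/andP; split; first by rewrite divr_ge0// ltW.
  by rewrite /p ler_pdivrMr// /cosh; lra.
have g1 := two_point_mgf_ge1 u p01; have g2 := two_point_mgf_le u p01.
have cs := cosh_shift u h; rewrite /= -/p in cs.
move: cs g1 g2; set G := p * _ + _ => cs g1 g2.
have G0 : 0 < G by exact: lt_le_trans g1.
rewrite -ln_div ?posrE ?cosh_gt0// cs lnM ?posrE ?expR_gt0//.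
rewrite expRK addrAC subrr add0r ln_ge0//=.
by rewrite -(expRK (8 * u ^+ 2)) ler_ln ?posrE ?expR_gt0.
Qed.

End exponential_inequalities.

(** * Expectations of bounded functions of i.i.d. coordinates *)

Section bounded_measurable.
Context d (T : measurableType d) (R : realType).
Implicit Types f g : T -> R.

Definition bounded_measurable f :=
  measurable_fun setT f /\ exists c, forall x, `|f x| <= c.

Lemma bounded_measurable_cst c : bounded_measurable (fun=> c).
Proof. by split; [exact: measurable_cst|exists `|c|]. Qed.

Lemma bounded_measurableD f g : bounded_measurable f -> bounded_measurable g ->
  bounded_measurable (fun x => f x + g x).
Proof.
move=> [mf [a fa]] [mg [b gb]]; split; first exact: measurable_funD.
by exists (a + b) => x; rewrite (le_trans (ler_normD _ _))// lerD.
Qed.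

Lemma bounded_measurableM f g : bounded_measurable f -> bounded_measurable g ->
  bounded_measurable (fun x => f x * g x).
Proof.
move=> [mf [a fa]] [mg [b gb]]; split; first exact: measurable_funM.
by exists (a * b) => x; rewrite normrM ler_pM.
Qed.

Lemma bounded_measurableB f g : bounded_measurable f -> bounded_measurable g ->
  bounded_measurable (fun x => f x - g x).
Proof.
move=> [mf [a fa]] [mg [b gb]]; split; first exact: measurable_funB.
by exists (a + b) => x; rewrite (le_trans (ler_normB _ _))// lerD.
Qed.

Lemma bounded_measurable_sum I (s : seq I) (p : pred I) (F : I -> T -> R) :
  (forall i, bounded_measurable (F i)) ->
  bounded_measurable (fun x => \sum_(i <- s | p i) F i x).
Proof.
move=> bF; elim: s => [|i s IHs].
  by under [X in bounded_measurable X]eq_fun do rewrite big_nil;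
    exact: bounded_measurable_cst.
under [X in bounded_measurable X]eq_fun do rewrite big_cons.
by case: (p i) => //; exact: bounded_measurableD.
Qed.

Lemma bounded_measurable_prod I (s : seq I) (p : pred I) (F : I -> T -> R) :
  (forall i, bounded_measurable (F i)) ->
  bounded_measurable (fun x => \prod_(i <- s | p i) F i x).
Proof.
move=> bF; elim: s => [|i s IHs].
  by under [X in bounded_measurable X]eq_fun do rewrite big_nil;
    exact: bounded_measurable_cst.
under [X in bounded_measurable X]eq_fun do rewrite big_cons.
by case: (p i) => //; exact: bounded_measurableM.
Qed.

Lemma bounded_measurable_expR f : bounded_measurable f ->
  bounded_measurable (fun x => expR (f x)).
Proof.
move=> [mf [a fa]]; split.
  by apply: measurableT_comp => //; exact: measurable_expR.
exists (expR a) => x; rewrite ger0_norm ?expR_ge0// ler_expR.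
exact: le_trans (ler_norm _) (fa x).
Qed.

Context (P : probability T R).

Lemma bounded_integrable f : bounded_measurable f ->
  P.-integrable setT (EFin \o f).
Proof.
move=> [mf [c fc]]; apply: measurable_bounded_integrable => //.
  exact: fin_num_fun_lty.
exists c; split; first exact: num_real.
by move=> x cx y _; exact: le_trans (fc y) (ltW cx).
Qed.

Lemma mean_cst c : \int[P]_x c = c.
Proof.
rewrite Rintegral_cst// (_ : fine (P setT) = 1) ?mulr1//.
by rewrite probability_setT.
Qed.

Lemma meanD f g : bounded_measurable f -> bounded_measurable g ->
  \int[P]_x (f x + g x) = \int[P]_x f x + \int[P]_x g x.
Proof. by move=> bf bg; rewrite RintegralD//; exact: bounded_integrable. Qed.

Lemma meanB f g : bounded_measurable f -> bounded_measurable g ->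
  \int[P]_x (f x - g x) = \int[P]_x f x - \int[P]_x g x.
Proof. by move=> bf bg; rewrite RintegralB//; exact: bounded_integrable. Qed.

Lemma meanZ c f : bounded_measurable f ->
  \int[P]_x (c * f x) = c * \int[P]_x f x.
Proof. by move=> bf; rewrite RintegralZl//; exact: bounded_integrable. Qed.

Lemma mean_sum I (s : seq I) (p : pred I) (F : I -> T -> R) :
  (forall i, bounded_measurable (F i)) ->
  \int[P]_x (\sum_(i <- s | p i) F i x) = \sum_(i <- s | p i) \int[P]_x F i x.
Proof.
move=> bF; elim: s => [|i s IHs].
  under eq_Rintegral do rewrite big_nil.
  by rewrite big_nil mean_cst.
under eq_Rintegral do rewrite big_cons.
rewrite big_cons; case: (p i) => //; rewrite meanD ?IHs//.
exact: bounded_measurable_sum.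
Qed.

Lemma mean_le f g : bounded_measurable f -> bounded_measurable g ->
  (forall x, f x <= g x) -> \int[P]_x f x <= \int[P]_x g x.
Proof.
by move=> bf bg fg; apply: le_Rintegral => //; exact: bounded_integrable.
Qed.

Lemma mean_ge0 f : (forall x, 0 <= f x) -> 0 <= \int[P]_x f x.
Proof. by move=> f0; exact: Rintegral_ge0. Qed.

Lemma EFin_mean f : bounded_measurable f ->
  (\int[P]_x f x)%:E = (\int[P]_x (f x)%:E)%E.
Proof.
move=> bf; rewrite /Rintegral fineK//.
exact: integrable_fin_num (bounded_integrable bf).
Qed.

End bounded_measurable.
#[local] Hint Resolve bounded_measurable_cst : core.

Lemma bounded_measurable_comp d d' (T : measurableType d)
    (T' : measurableType d') (R : realType) (u : T' -> T) (f : T -> R) :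
  measurable_fun setT u -> bounded_measurable f ->
  bounded_measurable (fun x => f (u x)).
Proof.
move=> mu [mf [a fa]]; split; first exact: measurableT_comp mf mu.
by exists a.
Qed.

Section iid_expectation.
Context d (T : measurableType d) (R : realType) (mu : probability T R).

Lemma mean_iid_recl n (f : n.+1.-tuple T -> R) : bounded_measurable f ->
  \int[iid_law mu n.+1]_h f h
  = \int[mu]_x \int[iid_law mu n]_t f (tuple_cons (x, t)).
Proof.
move=> bf.
have mc : measurable_fun setT (@tuple_cons _ T n) := @measurable_tuple_cons _ T n.
have bfc : bounded_measurable (fun z => f (tuple_cons z)).
  exact: bounded_measurable_comp.
have bfx x : bounded_measurable (fun t => f (tuple_cons (x, t))).
  by apply: bounded_measurable_comp bfc; exact: measurable_pair1.
have intf : (mu \x iid_law mu n)%E.-integrable setT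
    (fun z => (f (tuple_cons z))%:E).
  exact: (@bounded_integrable _ _ _ (mu \x iid_law mu n)%E _ bfc).
rewrite /Rintegral; congr fine.
rewrite /= integral_distribution//; last first.
  by apply/measurable_EFinP; case: bf.
rewrite -integral12_prod_meas1//.
apply: eq_integral => x _ /=; rewrite fineK//.
exact: integrable_fin_num (bounded_integrable (iid_law mu n) (bfx x)).
Qed.

Lemma mean_iid_prod n (f : 'I_n -> T -> R) :
  (forall i, bounded_measurable (f i)) ->
  \int[iid_law mu n]_h (\prod_(i < n) f i (tnth h i))
  = \prod_(i < n) \int[mu]_x f i x.
Proof.
elim: n f => [|n IHn] f bf.
  under eq_Rintegral do rewrite big_ord0.
  by rewrite big_ord0 mean_cst.
have btn m (g : 'I_m -> T -> R) : (forall i, bounded_measurable (g i)) ->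
    bounded_measurable (fun h : m.-tuple T => \prod_(i < m) g i (tnth h i)).
  move=> bg; apply: bounded_measurable_prod => i.
  by apply: bounded_measurable_comp (bg i); exact: measurable_tnth.
rewrite mean_iid_recl; last exact: (btn _ f bf).
rewrite big_ord_recl -IHn// mulrC -meanZ//.
apply: eq_Rintegral => x _.
rewrite mulrC -meanZ; last exact: (btn _ (fun i => f (lift ord0 i))).
apply: eq_Rintegral => t _.
rewrite big_ord_recl; congr (_ * _).
by apply: eq_bigr => i _; rewrite tnthS.
Qed.

Definition permute_tuple n (s : 'S_n) (h : n.-tuple T) : n.-tuple T :=
  [tuple tnth h (s i) | i < n].

Lemma measurable_permute_tuple n (s : 'S_n) :
  measurable_fun setT (permute_tuple s).
Proof.
apply/measurable_fun_tnthP => i.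
rewrite (_ : _ \o _ = @tnth _ T ^~ (s i)); first exact: measurable_tnth.
by apply/funext => h /=; rewrite tnth_mktuple.
Qed.

Definition rectangle n (A : 'I_n -> set T) : set (n.-tuple T) :=
  [set h | forall i, A i (tnth h i)].

Lemma measurable_rectangle n (A : 'I_n -> set T) :
  (forall i, measurable (A i)) -> measurable (rectangle A).
Proof.
move=> mA.
have -> : rectangle A = \bigcap_(i in [set: 'I_n]) (@tnth _ T ^~ i @^-1` A i).
  by apply/seteqP; split=> h /= hA; [move=> i _|move=> i]; exact: hA.
apply: fin_bigcap_measurable; first exact: finite_finset.
by move=> i _; rewrite -[X in measurable X]setTI; exact: measurable_tnth.
Qed.

Lemma iid_law_rectangle n (A : 'I_n -> set T) : (forall i, measurable (A i)) ->
  iid_law mu n (rectangle A) = (\prod_(i < n) \int[mu]_x \1_(A i) x)%:E.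
Proof.
move=> mA.
have bA i : bounded_measurable (\1_(A i) : T -> R).
  split; first exact: measurable_indic.
  by exists 1 => x; rewrite indicE; case: (_ \in _); rewrite ?normr1 ?normr0.
rewrite -(mean_iid_prod bA).
rewrite EFin_mean; last first.
  apply: bounded_measurable_prod => i.
  by apply: bounded_measurable_comp (bA i); exact: measurable_tnth.
transitivity (\int[iid_law mu n]_h (\1_(rectangle A) h)%:E)%E.
  by rewrite integral_indic ?setIT//; exact: measurable_rectangle.
apply: eq_integral => h _; congr EFin.
rewrite indicE; case: (boolP (h \in _)) => [/set_mem hA|].
  by rewrite big1// => i _; rewrite indicE mem_set//; exact: hA.
move=> /negP hA; apply/esym/eqP; rewrite prodf_seq_eq0; apply/hasP.
apply: contrapT => noi; apply: hA; apply/mem_set => i; apply: contrapT => hi.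
apply: noi; exists i; first exact: mem_index_enum.
by rewrite /= indicE memNset.
Qed.

(** Rectangles form a pi-system generating the measurable sets of tuples,
    and a permutation of the coordinates maps rectangles to rectangles of the
    same mass. *)
Lemma mean_iid_permute n (s : 'S_n) (f : n.-tuple T -> R) :
  bounded_measurable f ->
  \int[iid_law mu n]_h f (permute_tuple s h) = \int[iid_law mu n]_h f h.
Proof.
move=> bf.
have ms := measurable_permute_tuple s.
pose G := [set X | exists A : 'I_n -> set T,
  (forall i, measurable (A i)) /\ X = rectangle A].
have eqm A : measurable A ->
    pushforward (iid_law mu n) (permute_tuple s) A = iid_law mu n A.
  move=> mA.
  pose X := isMeasurableFun.Build _ _ _ _ _ ms.
  pose mf : {mfun n.-tuple T >-> n.-tuple T} := MeasurableFun.Pack (MeasurableFun.Class X).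
  rewrite -[LHS]/(distribution (iid_law mu n) mf A).
  apply: (@g_sigma_algebra_measure_unique_trace _ R _ G setT) => //.
  - by move=> B [[C [mC ->]] _]; exact: measurable_rectangle.
  - move=> B B' [[C [mC ->]] _] [[C' [mC' ->]] _]; split => //.
    exists (fun i => C i `&` C' i); split=> [i|]; first exact: measurableI.
    apply/seteqP; split => [h [hC hC'] i|h hCC']; first by split.
    by split => i; have [] := hCC' i.
  - move=> B [[C [mC ->]] _].
    transitivity (iid_law mu n (rectangle (fun i => C (s^-1 i)%g))).
      rewrite /= /distribution /pushforward /=; congr (iid_law mu n _).
      apply/seteqP; split => h /= hC i.
        by have := hC (s^-1 i)%g; rewrite tnth_mktuple permKV.
      by have := hC (s i); rewrite permK tnth_mktuple.
    rewrite iid_law_rectangle// [RHS](iid_law_rectangle mC); congr (_%:E).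
    by rewrite [RHS](reindex_inj (@perm_inj _ (s^-1)%g)).
  - exact: fin_num_fun_lty.
  move: A mA; apply: smallest_sub; first exact: smallest_sigma_algebra.
  move=> B; rewrite -bigcup_seq/= => -[i _ [C mC <-]].
  rewrite setTI; apply: sub_sigma_algebra; split => //.
  exists (fun j => if j == i then C else setT); split=> [j|].
    by case: ifP.
  apply/seteqP; split => h /=.
    by move=> hC j; case: eqP => // ->.
  by move=> /(_ i); rewrite eqxx.
rewrite /Rintegral; congr fine.
rewrite -(@integral_pushforward _ _ _ _ _ _ ms (iid_law mu n) setT (EFin \o f))//.
- by apply: eq_measure_integral => A mA _; exact: eqm.
- by apply/measurable_EFinP; case: bf.
- apply: bounded_integrable; exact: bounded_measurable_comp bf.
Qed.

(** By the permutation invariance it may be assumed that the coordinate is the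
    first one, where the recursive definition of the law separates it. *)
Lemma mean_iid_indep_coord n (i : 'I_n) (g : T -> R) (F : n.-tuple T -> R) :
  bounded_measurable g -> bounded_measurable F ->
  (forall h h', (forall j, j != i -> tnth h j = tnth h' j) -> F h = F h') ->
  \int[iid_law mu n]_h (g (tnth h i) * F h)
  = (\int[mu]_x g x) * \int[iid_law mu n]_h F h.
Proof.
case: n => [|n] in i F *; first by case: i.
move=> bg bF Fi.
pose s := tperm i ord0.
have bgi j : bounded_measurable (fun h : n.+1.-tuple T => g (tnth h j)).
  by apply: bounded_measurable_comp bg; exact: measurable_tnth.
have bFs : bounded_measurable (fun h => F (permute_tuple s h)).
  by apply: bounded_measurable_comp bF; exact: measurable_permute_tuple.
rewrite -(mean_iid_permute s bF) -(mean_iid_permute s); last first.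
  exact: bounded_measurableM.
have -> : (fun h => g (tnth (permute_tuple s h) i) * F (permute_tuple s h))
    = (fun h => g (tnth h ord0) * F (permute_tuple s h)).
  by apply/funext => h; rewrite tnth_mktuple tpermL.
pose J := \int[iid_law mu n]_t F (permute_tuple s (tuple_cons (point, t))).
have FJ x : (fun t => F (permute_tuple s (tuple_cons (x, t))))
    = (fun t => F (permute_tuple s (tuple_cons (point, t)))).
  apply/funext => t; apply: Fi => j ji.
  have : s j != ord0.
    by rewrite -(tpermL i ord0) (inj_eq perm_inj).
  rewrite !tnth_mktuple.
  by case: (unliftP ord0 (s j)) => [k ->|->]; rewrite ?eqxx// !tnthS.
have bt x : bounded_measurable (fun t => F (permute_tuple s (tuple_cons (x, t)))).
  apply: bounded_measurable_comp bFs.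
  by apply: measurableT_comp; [exact: measurable_tuple_cons|exact: measurable_pair1].
rewrite !mean_iid_recl//; last exact: bounded_measurableM.
transitivity (\int[mu]_x (J * g x)).
  apply: eq_Rintegral => x _; rewrite mulrC /J -(FJ x) -meanZ.
    by [].
  exact: bt.
rewrite meanZ// mulrC; congr (_ * _).
under [RHS]eq_Rintegral do rewrite FJ.
by rewrite mean_cst.
Qed.

End iid_expectation.

(** * The planted model *)

Section spin_sums.
Context {R : realType}.

Lemma sum_spins_prod n (F : 'I_n -> bool -> R) :
  \sum_(s : spins n) \prod_(i < n) F i (s i) = \prod_(i < n) (F i true + F i false).
Proof.
rewrite -bigA_distr_bigA/=; apply: eq_bigr => i _.
by rewrite big_bool.
Qed.

Lemma abs_spin n (s : spins n) i : `|spin s i| = 1 :> R.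
Proof. by rewrite /spin; case: (s i); rewrite ?normrN normr1. Qed.

Definition flip_spin n (i : 'I_n) (s : spins n) : spins n :=
  [ffun j => if j == i then ~~ s j else s j].

Lemma flip_spinK n (i : 'I_n) : involutive (flip_spin i).
Proof.
by move=> s; apply/ffunP => j; rewrite !ffunE; case: eqP => // _; rewrite negbK.
Qed.

Definition permute_spins n (p : 'S_n) (s : spins n) : spins n :=
  [ffun i => s (p i)].

Lemma permute_spinsK n (p : 'S_n) :
  cancel (permute_spins p) (permute_spins (p^-1)%g).
Proof. by move=> s; apply/ffunP => i; rewrite !ffunE permKV. Qed.

Definition plus_count n (S : {set 'I_n}) (s : spins n) : nat := #|[set i in S | s i]|.

Definition block_sum n (S : {set 'I_n}) (s : spins n) : R := \sum_(i in S) spin s i.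

Lemma block_sumE n (S : {set 'I_n}) (s : spins n) :
  block_sum S s = 2 * (plus_count S s)%:R - #|S|%:R.
Proof.
rewrite /block_sum /plus_count.
have -> : #|[set i in S | s i]| = (\sum_(i in S) s i)%N.
  rewrite -sum1_card big_mkcond [RHS]big_mkcond/=; apply: eq_bigr => i _.
  by rewrite inE; case: (i \in S); case: (s i).
rewrite -sum1_card !natr_sum mulr_sumr -sumrB; apply: eq_bigr => i _.
by rewrite /spin; case: (s i) => /=; ring.
Qed.

Lemma plus_count_le n (S : {set 'I_n}) (s : spins n) : (plus_count S s <= #|S|)%N.
Proof. by apply: subset_leq_card; apply/fintype.subsetP => i; rewrite inE => /andP[]. Qed.

End spin_sums.

Section gibbs.
Context {R : realType} (mu : probability (measurableTypeR R) R) (theta1 : R).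

Section fixed_size.
Context (n : nat) (S : {set 'I_n}).
Implicit Types (s : spins n) (h : n.-tuple R).

Local Notation weight := (gibbs_weight theta1 S).
Local Notation pcond := (planted_pmf_cond theta1 S).
Local Notation pmf := (planted_pmf mu theta1 S).

Lemma gibbs_weight_gt0 h s : 0 < weight h s.
Proof. exact: expR_gt0. Qed.

Lemma partition_gt0 h : 0 < \sum_(s' : spins n) weight h s'.
Proof.
rewrite (bigD1 [ffun=> true])//= ltr_pwDl ?gibbs_weight_gt0//.
by apply: sumr_ge0 => s _; exact/ltW/gibbs_weight_gt0.
Qed.

Lemma planted_pmf_cond_ge0 h s : 0 <= pcond h s.
Proof. by rewrite divr_ge0 ?ltW ?gibbs_weight_gt0 ?partition_gt0. Qed.

Lemma sum_planted_pmf_cond h : \sum_(s : spins n) pcond h s = 1.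
Proof. by rewrite -mulr_suml divff// gt_eqF// partition_gt0. Qed.

Lemma planted_pmf_cond_le1 h s : pcond h s <= 1.
Proof.
rewrite -(sum_planted_pmf_cond h) (bigD1 s)//= lerDl.
by apply: sumr_ge0 => *; exact: planted_pmf_cond_ge0.
Qed.

Lemma measurable_gibbs_weight s :
  measurable_fun setT (weight ^~ s : n.-tuple (measurableTypeR R) -> R).
Proof.
apply: measurableT_comp; first exact: measurable_expR.
apply: measurable_funD => //.
apply: measurable_sum => i.
by apply: measurable_funM => //; exact: measurable_tnth.
Qed.

Lemma bounded_measurable_planted_pmf_cond s :
  bounded_measurable (pcond ^~ s : n.-tuple (measurableTypeR R) -> R).
Proof.
split; last first.
  exists 1 => h; rewrite ger0_norm ?planted_pmf_cond_ge0//.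
  exact: planted_pmf_cond_le1.
(* The inverse of the positive partition function is written with [ln]. *)
rewrite (_ : (fun h => _) = fun h => weight h s
    * expR (- ln (\sum_(s' : spins n) weight h s'))); last first.
  by apply/funext => h; rewrite expRN lnK// posrE partition_gt0.
apply: measurable_funM; first exact: measurable_gibbs_weight.
apply: measurableT_comp; first exact: measurable_expR.
apply: measurable_funN; apply: measurableT_comp; first exact: measurable_ln.
by apply: measurable_sum => s'; exact: measurable_gibbs_weight.
Qed.
#[local] Hint Resolve bounded_measurable_planted_pmf_cond : core.

Lemma planted_pmfE s : pmf s = \int[iid_law mu n]_h pcond h s.
Proof. by rewrite /planted_pmf unlock. Qed.

Lemma planted_pmf_ge0 s : 0 <= pmf s.
Proof.
by rewrite planted_pmfE; apply: mean_ge0 => h; exact: planted_pmf_cond_ge0.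
Qed.

Lemma planted_pmf_mean (f : spins n -> R) :
  \sum_(s : spins n) pmf s * f s
  = \int[iid_law mu n]_h (\sum_(s : spins n) pcond h s * f s).
Proof.
rewrite mean_sum; last by move=> s; exact: bounded_measurableM.
apply: eq_bigr => s _; rewrite planted_pmfE mulrC -meanZ//.
by apply: eq_Rintegral => h _; rewrite mulrC.
Qed.

Lemma sum_planted_pmf : \sum_(s : spins n) pmf s = 1.
Proof.
under eq_bigr do rewrite -[pmf _]mulr1.
rewrite planted_pmf_mean -[RHS](mean_cst (iid_law mu n)).
apply: eq_Rintegral => h _; under eq_bigr do rewrite mulr1.
exact: sum_planted_pmf_cond.
Qed.

Lemma gibbs_weight_permute (p : 'S_n) h s : (forall i, (p i \in S) = (i \in S)) ->
  weight (permute_tuple p h) (permute_spins p s) = weight h s.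
Proof.
move=> pS; rewrite /gibbs_weight; congr expR; congr (_ * _ + _).
  rewrite [RHS](reindex_inj (@perm_inj _ p))/=.
  apply: eq_big => [i|i _]; first by rewrite pS.
  rewrite [RHS](reindex_inj (@perm_inj _ p))/=.
  apply: eq_big => [j|j _]; first by rewrite pS.
  by rewrite /spin !ffunE.
rewrite [RHS](reindex_inj (@perm_inj _ p))/=.
by apply: eq_bigr => i _; rewrite tnth_mktuple /spin ffunE.
Qed.

Lemma planted_pmf_permute (p : 'S_n) s : (forall i, (p i \in S) = (i \in S)) ->
  pmf (permute_spins p s) = pmf s.
Proof.
move=> pS; rewrite !planted_pmfE.
rewrite -(mean_iid_permute mu p (bounded_measurable_planted_pmf_cond (permute_spins p s))).
apply: eq_Rintegral => h _; rewrite /planted_pmf_cond gibbs_weight_permute//.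
congr (_ / _).
rewrite (reindex_inj (can_inj (permute_spinsK p)))/=.
by apply: eq_bigr => s' _; rewrite gibbs_weight_permute.
Qed.

End fixed_size.
End gibbs.

Section planted_symmetry.
Context {R : realType} (mu : probability (measurableTypeR R) R) (theta1 : R).
Hypothesis tanh_centered : \int[mu]_h tanh h = 0.
Context (n : nat) (S : {set 'I_n}).
Implicit Types (s : spins n) (h : n.-tuple R).

Local Notation weight := (gibbs_weight theta1 S).
Local Notation pcond := (planted_pmf_cond theta1 S).
Local Notation pmf := (planted_pmf mu theta1 S).

Lemma bounded_measurable_tanh : bounded_measurable (tanh : measurableTypeR R -> R).
Proof.
split; last by exists 1 => x; exact: abs_tanh_le1.
have me : measurable_fun setT (fun x : measurableTypeR R => expR (- x) : R).
  by apply: measurableT_comp => //; exact: measurable_expR.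
rewrite (_ : tanh = fun x => sinh x * expR (- ln (cosh x))); last first.
  by apply/funext => x; rewrite expRN lnK// posrE cosh_gt0.
have mE : measurable_fun setT (expR : measurableTypeR R -> R).
  exact: measurable_expR.
apply: measurable_funM.
  by apply: measurable_funM => //; exact: measurable_funB.
apply: measurableT_comp; first exact: measurable_expR.
apply: measurable_funN; apply: measurableT_comp; first exact: measurable_ln.
by apply: measurable_funM => //; exact: measurable_funD.
Qed.

(** Outside [S] the weight factorizes, so that flipping a site [i] there
    changes the conditional law by [tanh (h_i)] times a factor which does not
    depend on [h_i]; the mean of [tanh (h_i)] is zero. *)
Lemma planted_pmf_flip i s : i \notin S -> pmf (flip_spin i s) = pmf s.
Proof.
move=> iS.
pose G h s := expR (theta1 / (2 * #|S|%:R) *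
    (\sum_(i in S) \sum_(j in S) spin s i * spin s j)
  + \sum_(j < n | j != i) tnth h j * spin s j).
have wG h s' : weight h s' = expR (tnth h i * spin s' i) * G h s'.
  rewrite -expRD /gibbs_weight [X in _ + X](bigD1 i)//=; congr expR; ring.
have Gflip h s' : G h (flip_spin i s') = G h s'.
  rewrite /G; congr expR; congr (_ * _ + _).
    apply: eq_bigr => j jS; apply: eq_bigr => j' j'S; rewrite /spin !ffunE.
    have /negbTE -> : j != i by apply: contraNneq iS => <-.
    by have /negbTE -> : j' != i by apply: contraNneq iS => <-.
  by apply: eq_bigr => j /negbTE ji; rewrite /spin ffunE ji.
have spinf s' : spin (flip_spin i s') i = - spin s' i :> R.
  by rewrite /spin ffunE eqxx; case: (s' i); rewrite ?opprK.
have Gh h h' s' : (forall j, j != i -> tnth h j = tnth h' j) -> G h s' = G h' s'.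
  move=> hh'; rewrite /G; congr expR; congr (_ + _).
  by apply: eq_bigr => j ji; rewrite hh'.
have G0 h s' : 0 < G h s' by exact: expR_gt0.
pose Z h := \sum_(s' : spins n) G h s'.
have Z0 h : 0 < Z h.
  rewrite /Z (bigD1 s)//= ltr_pwDl//.
  by apply: sumr_ge0 => s' _; exact: ltW.
have ZE h : \sum_(s' : spins n) weight h s' = cosh (tnth h i) * Z h.
  apply: (mulfI (_ : 2 != 0 :> R)); first by rewrite pnatr_eq0.
  rewrite mulrDl mul1r {2}(reindex_inj (can_inj (flip_spinK i)))/=.
  rewrite -big_split /= /Z !mulr_sumr; apply: eq_bigr => s' _.
  rewrite !wG Gflip spinf -mulrDl mulrA; congr (_ * _).
  by rewrite /spin /cosh; case: (s' i); rewrite ?mulrN mulr1 ?opprK; field.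
pose F h := spin s i * 2 * (G h s / Z h).
have bG t : measurable_fun setT (fun h : n.-tuple (measurableTypeR R) => G h t).
  apply: measurableT_comp; first exact: measurable_expR.
  apply: measurable_funD => //.
  under [X in measurable_fun _ X]eq_fun do rewrite big_mkcond.
  apply: measurable_sum => j; case: (j != i) => //.
  by apply: measurable_funM => //; exact: measurable_tnth.
have bF : bounded_measurable (F : n.-tuple (measurableTypeR R) -> R).
  apply: bounded_measurableM; first exact: bounded_measurable_cst.
  split; last first.
    exists 1 => h; rewrite ger0_norm; last by rewrite divr_ge0 ?ltW.
    rewrite ler_pdivrMr ?Z0// mul1r /Z (bigD1 s)//= lerDl.
    by apply: sumr_ge0 => s' _; exact: ltW.
  rewrite (_ : (fun h => _) = fun h => G h s * expR (- ln (Z h))); last first.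
    by apply/funext => h; rewrite expRN lnK// posrE.
  apply: measurable_funM => //.
  apply: measurableT_comp; first exact: measurable_expR.
  apply: measurable_funN; apply: measurableT_comp; first exact: measurable_ln.
  exact: measurable_sum.
apply/eqP; rewrite eq_sym -subr_eq0 !planted_pmfE -meanB//; try
  exact: bounded_measurable_planted_pmf_cond.
have -> : (fun h => pcond h s - pcond h (flip_spin i s))
    = (fun h => tanh (tnth h i) * F h).
  apply/funext => h; rewrite /planted_pmf_cond ZE !wG Gflip spinf /F /tanh.
  have c0 := lt0r_neq0 (cosh_gt0 (tnth h i)); have z0 := lt0r_neq0 (Z0 h).
  have -> : expR (tnth h i * spin s i) = cosh (tnth h i) + spin s i * sinh (tnth h i).
    by rewrite /spin /cosh /sinh; case: (s i); rewrite ?mulrN1 ?mulr1; field.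
  have -> : expR (tnth h i * - spin s i) = cosh (tnth h i) - spin s i * sinh (tnth h i).
    by rewrite /spin /cosh /sinh; case: (s i); rewrite ?opprK ?mulrN1 ?mulr1; field.
  by field; rewrite c0 z0.
rewrite mean_iid_indep_coord//.
- by rewrite tanh_centered mul0r.
- exact: bounded_measurable_tanh.
- move=> h h' hh'; rewrite /F /Z (Gh _ _ _ hh'); congr (_ * (_ / _)).
  by apply: eq_bigr => s' _; exact: Gh.
Qed.

(** Two configurations with the same number of plus spins on [S] differ by
    flips outside [S] and transpositions inside [S]. *)
Lemma planted_pmf_plus_count s s' :
  plus_count S s = plus_count S s' -> pmf s = pmf s'.
Proof.
move En : #|[pred i | s i != s' i]| => N.
elim/ltn_ind: N s En => N IHN s En pc.
have dec (t : spins n) : (#|[pred i | t i != s' i]| < N)%N ->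
    plus_count S t = plus_count S s' -> pmf t = pmf s' by move=> lt; exact: IHN lt t erefl.
have [/existsP[i /andP[iS di]]|/existsPn noout] :=
    boolP [exists i, (i \notin S) && (s i != s' i)].
  rewrite -(planted_pmf_flip s iS); apply: dec.
    rewrite -En; apply: proper_card; apply/properP; split.
      apply/fintype.subsetP => j; rewrite !inE ffunE; case: (eqVneq j i) => [-> _|_] //.
    by exists i; rewrite !inE ?ffunE ?eqxx//; move: di; case: (s i); case: (s' i).
  rewrite -pc; apply: eq_card => j; rewrite !inE ffunE.
  by case: (eqVneq j i) => [->|_] //; rewrite (negbTE iS).
have sE j : j \notin S -> s j = s' j.
  by move=> jS; have := noout j; rewrite jS negbK => /eqP.
have [/existsP[i /and3P[iS si s'i]]|/existsPn noi] :=
    boolP [exists i, [&& i \in S, s i & ~~ s' i]]; last first.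
  have sub : [set i in S | s i] \subset [set i in S | s' i].
    apply/fintype.subsetP => j; rewrite !inE => /andP[jS sj].
    by have := noi j; rewrite jS sj /= negbK => ->.
  have := pc; rewrite /plus_count => /eqP; rewrite eqn_leq => /andP[_ le].
  have /eqP seq : [set i in S | s i] == [set i in S | s' i].
    by rewrite eqEcard sub.
  congr pmf; apply/ffunP => j; have [jS|jS] := boolP (j \in S); last exact: sE.
  by have := congr1 (fun A : {set 'I_n} => j \in A) seq; rewrite !inE jS.
have [/existsP[j /and3P[jS sj s'j]]|/existsPn noj] :=
    boolP [exists j, [&& j \in S, ~~ s j & s' j]]; last first.
  have sub : [set i in S | s' i] \proper [set i in S | s i].
    apply/properP; split.
      apply/fintype.subsetP => j; rewrite !inE => /andP[jS sj].
      by have := noj j; rewrite jS sj andbT /= negbK => ->.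
    by exists i; rewrite !inE iS ?si// (negbTE s'i).
  by have := proper_card sub; rewrite -/(plus_count S s') -/(plus_count S s) pc ltnn.
have ij : i != j by apply: contraNneq sj => <-.
pose p := tperm i j.
have pS k : (p k \in S) = (k \in S).
  by rewrite /p; case: tpermP => [->|->|//]; rewrite iS jS.
rewrite -(planted_pmf_permute mu theta1 s pS); apply: dec.
  rewrite -En; apply: proper_card; apply/properP; split.
    apply/fintype.subsetP => k; rewrite !inE ffunE /p; case: tpermP => // ->.
      by rewrite (negbTE sj) (negbTE s'i).
    by rewrite si s'j.
  exists i; rewrite !inE ?ffunE /p ?tpermL; first by rewrite si (negbTE s'i).
  by rewrite (negbTE sj) (negbTE s'i).
rewrite -pc /plus_count -(card_imset _ (@perm_inj _ p)).
apply: eq_card => k; rewrite -[k in LHS](permKV p) mem_imset ?inE; last exact: perm_inj.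
by rewrite ffunE permKV -(pS (p^-1 k)%g) permKV.
Qed.

End planted_symmetry.

(** * Comparison with product measures *)

Section plus_classes.
Context (n : nat) (S : {set 'I_n}).
Implicit Types (s : spins n).

Lemma plus_countE s : plus_count S s = (\sum_(i in S) s i)%N.
Proof.
rewrite /plus_count -sum1_card big_mkcond [RHS]big_mkcond/=; apply: eq_bigr => i _.
by rewrite inE; case: (i \in S); case: (s i).
Qed.

Lemma plus_count_flip a s : a \in S -> ~~ s a ->
  plus_count S (flip_spin a s) = (plus_count S s).+1.
Proof.
move=> aS sa; rewrite !plus_countE (bigD1 a)//= [in RHS](bigD1 a)//=.
rewrite ffunE eqxx sa (negbTE sa) add0n add1n; congr _.+1.
by apply: eq_bigr => i /andP[_ /negbTE ia]; rewrite ffunE ia.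
Qed.

(** Double counting of the pairs made of a configuration with [i + 1] plus
    spins on [S] and one of these spins, which is flipped. *)
Lemma card_plus_class i : (i < #|S|)%N ->
  (#|[pred s | plus_count S s == i.+1]| * i.+1
   = #|[pred s | plus_count S s == i]| * (#|S| - i))%N.
Proof.
move=> iS.
transitivity (\sum_(a in S) \sum_(s | plus_count S s == i.+1) s a)%N.
  rewrite exchange_big/= -sum_nat_const; apply: eq_bigr => s /eqP <-.
  by rewrite plus_countE.
transitivity (\sum_(a in S) \sum_(s | plus_count S s == i) ~~ s a)%N.
  apply: eq_bigr => a aS; rewrite (reindex_inj (can_inj (flip_spinK a)))/=.
  rewrite big_mkcond [RHS]big_mkcond/=; apply: eq_bigr => s _.
  rewrite ffunE eqxx; case: (boolP (s a)) => sa; last first.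
    by rewrite plus_count_flip// eqSS.
  by rewrite !if_same.
rewrite exchange_big/= -sum_nat_const; apply: eq_bigr => s /eqP <-.
rewrite plus_countE -sum1_card.
under [in RHS]eq_bigr do [].
apply/eqP; rewrite -(eqn_add2l (\sum_(a in S) s a)) -big_split/= subnKC; last first.
  by apply: leq_sum => a _; exact: leq_b1.
by apply/eqP; apply: eq_bigr => a _; case: (s a).
Qed.

End plus_classes.

(** The mode of a binomial law of integral mean [j]: consecutive weights have
    the ratio [(k - i) j / ((i + 1) (k - j))], at least 1 for [i < j] and at
    most 1 afterwards. *)
Lemma binomial_mode (N : nat -> nat) (k j : nat) :
  (forall i, (i < k)%N -> N i.+1 * i.+1 = N i * (k - i))%N -> (j <= k)%N ->
  forall i, (i <= k)%N ->
  (N i * (j ^ i * (k - j) ^ (k - i)) <= N j * (j ^ j * (k - j) ^ (k - j)))%N.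
Proof.
move=> NS jk.
pose u i := (N i * (j ^ i * (k - j) ^ (k - i)))%N.
have uS i : (i < k)%N -> (u i.+1 * (i.+1 * (k - j)) = u i * ((k - i) * j))%N.
  move=> ik; rewrite /u.
  have -> : (k - i = (k - i.+1).+1)%N by lia.
  rewrite [in RHS]expnS expnS.
  have := NS _ ik; have -> : (k - i = (k - i.+1).+1)%N by lia.
  move=> e.
  transitivity ((N i.+1 * i.+1) * (j * j ^ i * ((k - j) * (k - j) ^ (k - i.+1))))%N.
    by ring.
  by rewrite e; ring.
have up i : (i < j)%N -> (u i <= u i.+1)%N.
  move=> ij; have ik : (i < k)%N by exact: leq_trans ij jk.
  rewrite -(@leq_pmul2r ((k - i) * j)) -?uS//; last by rewrite muln_gt0; lia.
  by rewrite leq_mul2l; apply/orP; right; rewrite mulnC; apply: leq_mul; lia.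
have down i : (j <= i)%N -> (i < k)%N -> (u i.+1 <= u i)%N.
  move=> ji ik.
  rewrite -(@leq_pmul2r (i.+1 * (k - j))) ?uS//; last by rewrite muln_gt0; lia.
  by rewrite leq_mul2l; apply/orP; right; rewrite mulnC; apply: leq_mul; lia.
have upj d : (d <= j)%N -> (u (j - d) <= u j)%N.
  elim: d => [|d IHd] dj; first by rewrite subn0.
  apply: leq_trans (IHd (ltnW dj)).
  have -> : (j - d = (j - d.+1).+1)%N by lia.
  by apply: up; lia.
have downj d : (j + d <= k)%N -> (u (j + d) <= u j)%N.
  elim: d => [|d IHd] dk; first by rewrite addn0.
  apply: leq_trans (IHd _); last by lia.
  by rewrite addnS; apply: down; lia.
move=> i ik; have [ij|ji] := leqP i j.
  have -> : i = (j - (j - i))%N by lia.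
  by apply: upj; lia.
have -> : i = (j + (i - j))%N by lia.
by apply: downj; lia.
Qed.

Lemma natr_mul_sum_ord (R : pzRingType) m (y : R) : m%:R * y = \sum_(i < m) y.
Proof. by rewrite sumr_const card_ord mulr_natl. Qed.

Section product_law.
Context {R : realType} (n : nat) (S : {set 'I_n}).
Implicit Types (s : spins n) (p u : R).

Definition site_law p (i : 'I_n) (b : bool) : R :=
  if i \in S then if b then p else 1 - p else 2^-1.

Definition product_law p s : R := \prod_(i < n) site_law p i (s i).

Lemma sum_product_law p : \sum_(s : spins n) product_law p s = 1.
Proof.
rewrite sum_spins_prod big1// => i _; rewrite /site_law.
by case: (i \in S); [rewrite addrC subrK|field].
Qed.

Lemma product_law_ge0 p s : 0 <= p <= 1 -> 0 <= product_law p s.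
Proof.
move=> /andP[p0 p1]; apply: prodr_ge0 => i _; rewrite /site_law.
by case: (i \in S); case: (s i) => //; lra.
Qed.

Lemma product_lawE p s : product_law p s
  = p ^+ plus_count S s * (1 - p) ^+ (#|S| - plus_count S s) * 2^-1 ^+ #|~: S|.
Proof.
rewrite /product_law (bigID (mem S))/=; congr (_ * _); last first.
  rewrite -prodr_const; apply: eq_big => [i|i /negbTE iS]; first by rewrite inE.
  by rewrite /site_law iS.
rewrite (bigID s)/=; congr (_ * _).
  rewrite /plus_count -prodr_const; apply: eq_big => [i|i /andP[iS si]].
    by rewrite inE.
  by rewrite /site_law iS si.
have -> : (#|S| - plus_count S s = #|[set i in S | ~~ s i]|)%N.
  rewrite /plus_count -(cardsID (finset s) S).
  rewrite (_ : S :&: finset s = [set i in S | s i]); last first.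
    by apply/setP => i; rewrite !inE.
  rewrite addKn; apply: eq_card => i; rewrite !inE andbC//.
rewrite -prodr_const; apply: eq_big => [i|i /andP[iS /negbTE si]].
  by rewrite inE.
by rewrite /site_law iS si.
Qed.

(** The centring on [S] is free because the coefficients sum to zero there. *)
Lemma product_law_mgf p u (c : 'I_n -> R) : 0 <= p <= 1 ->
  \sum_(i in S) c i = 0 ->
  \sum_(s : spins n) product_law p s * expR (u * \sum_(i < n) c i * spin s i)
  <= expR (8 * u ^+ 2 * \sum_(i < n) c i ^+ 2).
Proof.
move=> p01 cS.
pose q i := if i \in S then p else 2^-1.
have q01 i : 0 <= q i <= 1.
  by rewrite /q; case: ifP => // _; apply/andP; split; lra.
have cq : \sum_(i < n) c i * (2 * q i - 1) = 0.
  rewrite (bigID (mem S))/= [X in _ + X]big1 ?addr0; last first.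
    by move=> i /negbTE iS; rewrite /q iS mulfV ?pnatr_eq0// subrr mulr0.
  under eq_bigr => i iS do rewrite /q iS.
  by rewrite -mulr_suml cS mul0r.
have -> : \sum_(s : spins n) product_law p s * expR (u * \sum_(i < n) c i * spin s i)
    = \sum_(s : spins n) \prod_(i < n) (site_law p i (s i)
        * expR (u * c i * ((if s i then 1 else -1) - (2 * q i - 1)))).
  apply: eq_bigr => s _; rewrite big_split/= -expR_sum; congr (_ * expR _).
  transitivity (u * (\sum_(i < n) c i * spin s i - \sum_(i < n) c i * (2 * q i - 1))).
    by rewrite cq subr0.
  rewrite -sumrB mulr_sumr; apply: eq_bigr => i _.
  by rewrite /spin; case: (s i); ring.
rewrite (sum_spins_prod (fun i b => site_law p i b
  * expR (u * c i * ((if b then 1 else -1) - (2 * q i - 1))))).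
rewrite mulr_sumr expR_sum; apply: ler_prod => i _.
have -> : site_law p i true = q i by rewrite /site_law /q.
have -> : site_law p i false = 1 - q i.
  by rewrite /site_law /q; case: ifP => // _; lra.
have /andP[q0 q1] := q01 i.
rewrite addr_ge0 ?mulr_ge0 ?expR_ge0 ?subr_ge0//=.
have -> : 8 * u ^+ 2 * c i ^+ 2 = 8 * (u * c i) ^+ 2 by ring.
exact: two_point_mgf_le.
Qed.

End product_law.

Section planted_domination.
Context {R : realType} (mu : probability (measurableTypeR R) R) (theta1 : R).
Hypothesis tanh_centered : \int[mu]_h tanh h = 0.
Context (n : nat) (S : {set 'I_n}).
Hypothesis S_gt0 : (0 < #|S|)%N.
Implicit Types (s : spins n).

Local Notation pmf := (planted_pmf mu theta1 S).
Local Notation k := #|S|.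

Let ratio01 j : (j <= k)%N -> 0 <= (j%:R / k%:R : R) <= 1.
Proof.
move=> jk; rewrite divr_ge0//= ler_pdivrMr ?ltr0n// mul1r ler_nat//.
Qed.

(** The planted law is uniform on each class of [plus_count S]; the product law
    whose density on [S] matches the class is uniform there as well and, by
    [binomial_mode], gives it mass at least [1 / (k + 1)]. *)
Lemma planted_pmf_le_product_law s :
  pmf s <= k.+1%:R * product_law S ((plus_count S s)%:R / k%:R) s.
Proof.
set j := plus_count S s; set Q := product_law S _.
have jk : (j <= k)%N := plus_count_le S s.
pose N i := #|[pred t : spins n | plus_count S t == i]|.
have k0 : k%:R != 0 :> R by rewrite pnatr_eq0 -lt0n.
pose c0 : R := 2^-1 ^+ #|~: S| / k%:R ^+ k.
have c00 : 0 <= c0 by rewrite divr_ge0 ?exprn_ge0// invr_ge0.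
have QE t : Q t = (j ^ plus_count S t * (k - j) ^ (k - plus_count S t))%:R * c0.
  have tk := plus_count_le S t.
  have kk : k%:R ^+ k = k%:R ^+ plus_count S t * k%:R ^+ (k - plus_count S t) :> R.
    by rewrite -exprD subnKC.
  rewrite /Q product_lawE natrM !natrX natrB// /c0 kk.
  have -> : 1 - j%:R / k%:R = (k%:R - j%:R) / k%:R :> R by field.
  rewrite !expr_div_n; field; rewrite !expf_neq0//.
have massE i : \sum_(t : spins n | plus_count S t == i) Q t
    = (N i * (j ^ i * (k - j) ^ (k - i)))%:R * c0.
  under eq_bigr => t /eqP ti do rewrite QE ti.
  by rewrite sumr_const -[LHS]mulr_natl mulrA -natrM.
have mode i : (i <= k)%N ->
    \sum_(t : spins n | plus_count S t == i) Q t <= (N j)%:R * Q s.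
  move=> ik; rewrite massE QE mulrA -natrM ler_wpM2r// ler_nat.
  exact: (@binomial_mode N k j (@card_plus_class n S) jk i ik).
have tot : 1 <= k.+1%:R * ((N j)%:R * Q s).
  rewrite -[leLHS](sum_product_law S (j%:R / k%:R)) -/Q.
  have -> : \sum_(t : spins n) Q t
      = \sum_(i < k.+1) \sum_(t : spins n | plus_count S t == i) Q t.
    rewrite (partition_big (fun t => inord (plus_count S t) : 'I_k.+1) predT)//=.
    apply: eq_bigr => i _; apply: eq_bigl => t.
    by rewrite -val_eqE/= inordK// ltnS plus_count_le.
  rewrite natr_mul_sum_ord.
  by apply: ler_sum => i _; apply: mode; rewrite -ltnS.
have mass_le1 : (N j)%:R * pmf s <= 1.
  rewrite -[leRHS](sum_planted_pmf mu theta1 S) mulr_natl -sumr_const.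
  rewrite [leRHS](bigID (fun t => plus_count S t == j))/=.
  rewrite -[leLHS]addr0 lerD//.
    rewrite le_eqVlt; apply/orP; left; apply/eqP; apply: eq_bigr => t /eqP tj.
    exact: planted_pmf_plus_count.
  by apply: sumr_ge0 => t _; exact: planted_pmf_ge0.
have Q0 : 0 <= Q s by rewrite product_law_ge0// ratio01.
rewrite -[leLHS]mulr1; apply: le_trans (ler_wpM2l (planted_pmf_ge0 _ _ _ _) tot) _.
have -> : pmf s * (k.+1%:R * ((N j)%:R * Q s)) = k.+1%:R * Q s * ((N j)%:R * pmf s).
  by ring.
by rewrite -[leRHS]mulr1 ler_wpM2l// mulr_ge0.
Qed.

(** The class of a configuration is random, so the product laws of all the
    classes are added up, at the cost of a second factor [k + 1]. *)
Lemma planted_mgf (u : R) (c : 'I_n -> R) : \sum_(i in S) c i = 0 ->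
  \sum_(s : spins n) pmf s * expR (u * \sum_(i < n) c i * spin s i)
  <= k.+1%:R ^+ 2 * expR (8 * u ^+ 2 * \sum_(i < n) c i ^+ 2).
Proof.
move=> cS; set f := fun s : spins n => expR (u * \sum_(i < n) c i * spin s i).
apply: (@le_trans _ _ (\sum_(s : spins n) \sum_(j < k.+1)
    k.+1%:R * product_law S (j%:R / k%:R) s * f s)).
  apply: ler_sum => s _.
  have lt : (plus_count S s < k.+1)%N by rewrite ltnS plus_count_le.
  rewrite (bigD1 (Ordinal lt))//= -[leLHS]addr0 lerD//.
    by rewrite ler_wpM2r ?expR_ge0// planted_pmf_le_product_law.
  apply: sumr_ge0 => j _; rewrite mulr_ge0 ?expR_ge0// mulr_ge0//.
  by rewrite product_law_ge0// ratio01// -ltnS.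
rewrite exchange_big/= expr2 -mulrA natr_mul_sum_ord; apply: ler_sum => j _.
under eq_bigr do rewrite -mulrA.
rewrite -mulr_sumr ler_wpM2l// product_law_mgf// ratio01// -ltnS//.
Qed.

(** With [z] an integer at distance at most 1 of [w],
    [w^2 <= 2 z w - z^2 + 1]; summing over the possible values of [z] reduces
    the square exponential to exponentials of linear functions. *)
Lemma planted_square_mgf (c : 'I_n -> R) : \sum_(i in S) c i = 0 ->
  (forall i, `|c i| <= 1) -> \sum_(i < n) `|c i| <= 2 * k%:R ->
  \sum_(s : spins n) pmf s * expR ((\sum_(i < n) c i * spin s i) ^+ 2 / (64 * k%:R))
  <= expR 1 * (4 * k).+1%:R * k.+1%:R ^+ 2.
Proof.
move=> cS c1 cabs.
pose W (s : spins n) := \sum_(i < n) c i * spin s i.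
have k1 : 1 <= k%:R :> R by rewrite ler1n.
have k0 : 0 < k%:R :> R by lra.
have Wk s : `|W s| <= 2 * k%:R.
  apply: le_trans cabs; apply: le_trans (ler_norm_sum _ _ _) _.
  by apply: ler_sum => i _; rewrite normrM abs_spin mulr1.
pose z (i : 'I_(4 * k).+1) : R := i%:R - 2 * k%:R.
have zW s : exists i, (W s - z i) ^+ 2 <= 1.
  have w0 : 0 <= W s + 2 * k%:R.
    by have := Wk s; rewrite ler_norml => /andP[]; lra.
  have /andP[t1 t2] := truncn_itv w0.
  have lt : (Num.truncn (W s + 2 * k%:R) < (4 * k).+1)%N.
    rewrite ltnS -(ler_nat R) (le_trans t1)//.
    by have := Wk s; rewrite ler_norml natrM => /andP[]; lra.
  exists (Ordinal lt); rewrite /z /=.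
  by rewrite -natr1 in t2; apply: exprn_ile1; lra.
have pointwise s : expR (W s ^+ 2 / (64 * k%:R))
    <= expR 1 * \sum_i expR (- (z i ^+ 2 / (64 * k%:R)))
        * expR (2 * z i / (64 * k%:R) * W s).
  have [i zi] := zW s.
  rewrite (bigD1 i)//= mulrDr -[leLHS]addr0 lerD//; last first.
    rewrite mulr_ge0 ?expR_ge0//; apply: sumr_ge0 => j _.
    by rewrite mulr_ge0 ?expR_ge0.
  rewrite -!expRD ler_expR.
  have -> : 1 + (- (z i ^+ 2 / (64 * k%:R)) + 2 * z i / (64 * k%:R) * W s)
      = W s ^+ 2 / (64 * k%:R) + (1 - (W s - z i) ^+ 2 / (64 * k%:R)).
    by field; rewrite gt_eqF.
  rewrite lerDl subr_ge0 ler_pdivrMr ?mulr_gt0//; lra.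
apply: (@le_trans _ _ (\sum_(s : spins n) pmf s * (expR 1 *
   \sum_i expR (- (z i ^+ 2 / (64 * k%:R))) * expR (2 * z i / (64 * k%:R) * W s)))).
  by apply: ler_sum => s _; rewrite ler_wpM2l ?planted_pmf_ge0 ?pointwise.
under eq_bigr do rewrite mulrCA.
rewrite -mulr_sumr -mulrA ler_wpM2l ?expR_ge0//.
under eq_bigr do rewrite mulr_sumr.
rewrite exchange_big/= [leRHS]natr_mul_sum_ord.
apply: ler_sum => i _.
under eq_bigr do rewrite mulrCA.
rewrite -mulr_sumr.
apply: le_trans (ler_wpM2l (expR_ge0 _) (planted_mgf _ cS)) _.
rewrite mulrCA -[leRHS]mulr1 ler_wpM2l ?exprn_ge0// -expRD expR_le1.
have c2 : \sum_(i < n) c i ^+ 2 <= 2 * k%:R.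
  apply: le_trans cabs; apply: ler_sum => j _.
  by rewrite -real_normK ?num_real// expr2 ler_piMl.
have -> : - (z i ^+ 2 / (64 * k%:R)) = - (8 * (2 * z i / (64 * k%:R)) ^+ 2 * (2 * k%:R)).
  by field; rewrite gt_eqF.
by rewrite addrC subr_le0 ler_wpM2l// mulr_ge0 ?sqr_ge0.
Qed.

End planted_domination.

(** * The conditional law of the magnetization *)

Section gibbs_magnetization.
Context {R : realType} (theta1 : R).
Hypothesis theta1_gt0 : 0 < theta1.
Implicit Types x h : R.

Local Notation sq := (Num.sqrt theta1).

Definition cosh_log_ratio x h : R := ln (cosh (sq * x + h)) - ln (cosh h).

Context (n : nat) (S : {set 'I_n}).
Hypothesis S_gt0 : (0 < #|S|)%N.
Local Notation k := #|S|.
Local Notation weight := (gibbs_weight theta1 S).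
Local Notation pcond := (planted_pmf_cond theta1 S).

(** The exponent of the partition function after linearization of the quadratic
    interaction at the point [x]. *)
Definition tilted_energy (h : n.-tuple R) x : R :=
  \sum_(i in S) cosh_log_ratio x (tnth h i) - k%:R * x ^+ 2 / 2.

Lemma gibbs_weightE (h : n.-tuple R) (s : spins n) :
  weight h s = expR (theta1 / (2 * k%:R) * block_sum S s ^+ 2
                     + \sum_(i < n) tnth h i * spin s i).
Proof.
rewrite /gibbs_weight; congr expR; congr (_ * _ + _).
by rewrite expr2 /block_sum mulr_suml; apply: eq_bigr => i _; rewrite mulr_sumr.
Qed.

Lemma tilted_sum (h : n.-tuple R) x :
  \sum_(s : spins n) expR (sq * x * block_sum S s + \sum_(i < n) tnth h i * spin s i)
  = \prod_(i < n) (2 * cosh (tnth h i))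
    * expR (\sum_(i in S) cosh_log_ratio x (tnth h i)).
Proof.
pose a i := tnth h i + (if i \in S then sq * x else 0).
transitivity (\sum_(s : spins n) \prod_(i < n) expR (a i * (if s i then 1 else -1))).
  apply: eq_bigr => s _; rewrite -expR_sum; congr expR.
  rewrite /block_sum mulr_sumr big_mkcond -big_split/=; apply: eq_bigr => i _.
  by rewrite /a /spin; case: (i \in S); case: (s i); ring.
rewrite (sum_spins_prod (fun i b => expR (a i * (if b then 1 else -1)))).
rewrite expR_sum [X in _ = _ * X]big_mkcond -big_split/=; apply: eq_bigr => i _.
have -> : expR (a i * 1) + expR (a i * -1) = 2 * cosh (a i).
  by rewrite mulr1 mulrN1 /cosh; field.
rewrite /a; case: (i \in S); last by rewrite addr0 mulr1.
rewrite /cosh_log_ratio -ln_div ?posrE ?cosh_gt0// lnK ?posrE ?divr_gt0 ?cosh_gt0//.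
- by rewrite [sq * x + _]addrC; field; rewrite gt_eqF ?cosh_gt0.
- by rewrite addr_gt0 ?expR_gt0.
- by rewrite addr_gt0 ?expR_gt0.
Qed.

Lemma sqr_sqrt_theta : sq ^+ 2 = theta1.
Proof. by rewrite sqr_sqrtr// ltW. Qed.

Lemma k_gt0 : 0 < k%:R :> R.
Proof. by rewrite ltr0n. Qed.

(** [theta1 B^2 / (2 k)] is the maximum over [x] of
    [sqrt theta1 x B - k x^2 / 2], attained at [x = sqrt theta1 B / k]. *)
Lemma partition_ge (h : n.-tuple R) x :
  \prod_(i < n) (2 * cosh (tnth h i)) * expR (tilted_energy h x)
  <= \sum_(s : spins n) weight h s.
Proof.
rewrite /tilted_energy expRD mulrA -tilted_sum mulr_suml.
apply: ler_sum => s _; rewrite gibbs_weightE -expRD ler_expR.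
rewrite addrAC lerD2r -subr_ge0.
have -> : theta1 / (2 * k%:R) * block_sum S s ^+ 2
    - (sq * x * block_sum S s - k%:R * x ^+ 2 / 2)
    = (sq * block_sum S s - k%:R * x) ^+ 2 / (2 * k%:R).
  by rewrite -{1}sqr_sqrt_theta; field; rewrite gt_eqF ?k_gt0.
by rewrite divr_ge0 ?sqr_ge0// mulr_ge0// ltW ?k_gt0.
Qed.

Lemma partition_class_le (h : n.-tuple R) (b : R) :
  \sum_(s : spins n | block_sum S s == b) weight h s
  <= \prod_(i < n) (2 * cosh (tnth h i)) * expR (tilted_energy h (sq * b / k%:R)).
Proof.
rewrite /tilted_energy expRD mulrA -tilted_sum mulr_suml.
rewrite [leRHS](bigID (fun s => block_sum S s == b))/= -[leLHS]addr0 lerD//; last first.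
  by apply: sumr_ge0 => s _; rewrite mulr_ge0 ?expR_ge0.
apply: ler_sum => s /eqP sb; rewrite gibbs_weightE -expRD ler_expR sb.
rewrite addrAC lerD2r le_eqVlt; apply/orP; left; apply/eqP.
by rewrite -{1}sqr_sqrt_theta; field; rewrite gt_eqF ?k_gt0.
Qed.

(** The magnetization takes at most [k + 1] values, so each class may be compared
    separately with the lower bound of the partition function at one point. *)
Lemma small_magnetization_le (h : n.-tuple R) (bound D x : R) :
  (forall j, (j <= k)%N -> `|2 * j%:R - k%:R| < bound ->
     tilted_energy h (sq * (2 * j%:R - k%:R) / k%:R) <= tilted_energy h x - D) ->
  \sum_(s : spins n | `|block_sum S s| < bound) pcond h s <= k.+1%:R * expR (- D).
Proof.
move=> hD; rewrite -mulr_suml ler_pdivrMr ?partition_gt0//.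
have W0 : 0 < \prod_(i < n) (2 * cosh (tnth h i)).
  by apply: prodr_gt0 => i _; rewrite mulr_gt0 ?cosh_gt0.
have Zge := partition_ge h x.
apply: (@le_trans _ _ (k.+1%:R * expR (- D)
    * (\prod_(i < n) (2 * cosh (tnth h i)) * expR (tilted_energy h x)))); last first.
  by rewrite ler_wpM2l// mulr_ge0 ?expR_ge0.
rewrite -mulrA natr_mul_sum_ord.
rewrite (partition_big (fun s => inord (plus_count S s) : 'I_k.+1) predT)//=.
apply: ler_sum => j _.
pose b : R := 2 * j%:R - k%:R.
have jk : (j <= k)%N by rewrite -ltnS.
have jE s : (inord (plus_count S s) == j :> 'I_k.+1) -> block_sum S s = b.
  move=> /eqP e; rewrite block_sumE /b -e inordK// ltnS plus_count_le//.
have [bb|bb] := ltP `|b| bound; last first.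
  rewrite big1 ?mulr_ge0 ?expR_ge0 ?(ltW W0)//.
  by move=> s /andP[+ /jE e]; rewrite e ltNge bb.
apply: (@le_trans _ _ (\sum_(s : spins n | block_sum S s == b) weight h s)).
  rewrite [leLHS]big_mkcond [leRHS]big_mkcond/=; apply: ler_sum => s _.
  case: ifP => [/andP[_ /jE ->]|_]; first by rewrite eqxx.
  by case: ifP => // _; exact/ltW/gibbs_weight_gt0.
apply: le_trans (partition_class_le h b) _.
rewrite mulrCA ler_wpM2l ?(ltW W0)// -expRD ler_expR addrC.
exact: hD.
Qed.

(** On the complement of [|B| < bound] the Laplace factor is at most
    [expR (- (v * bound ^+ 2))], and elsewhere it is at most 1. *)
Lemma magnetization_laplace_le (h : n.-tuple R) (bound v : R) :
  0 <= v -> 0 <= bound ->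
  \sum_(s : spins n) pcond h s * expR (- (v * block_sum S s ^+ 2))
  <= 1 - (1 - expR (- (v * bound ^+ 2)))
         * (1 - \sum_(s : spins n | `|block_sum S s| < bound) pcond h s).
Proof.
move=> v0 b0; set rho := \sum_(s | _) pcond h s; set e := expR (- (v * bound ^+ 2)).
have rest : \sum_(s : spins n | ~~ (`|block_sum S s| < bound)) pcond h s = 1 - rho.
  have := sum_planted_pmf_cond theta1 S h.
  by rewrite (bigID (fun s => `|block_sum S s| < bound))/= -/rho; lra.
rewrite (bigID (fun s => `|block_sum S s| < bound))/=.
have -> : 1 - (1 - e) * (1 - rho) = rho + e * (1 - rho) by ring.
apply: lerD.
  apply: ler_sum => s _; rewrite ler_piMr ?planted_pmf_cond_ge0// expR_le1.
  by rewrite oppr_le0 mulr_ge0 ?sqr_ge0.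
rewrite -rest mulr_sumr; apply: ler_sum => s; rewrite -leNgt => bs.
rewrite mulrC ler_wpM2r ?planted_pmf_cond_ge0// ler_expR lerN2 ler_wpM2l//.
by rewrite -[leRHS]real_normK ?num_real// ler_sqr ?nnegrE.
Qed.

End gibbs_magnetization.

(** * Sums of centred functions of the field *)

Section iid_sums.
Context d (T : measurableType d) (R : realType) (mu : probability T R).
Context (n : nat) (S : {set 'I_n}) (g : T -> R) (L : R).
Hypothesis bg : bounded_measurable g.
Hypothesis g_le : forall x, `|g x| <= L.
Hypothesis g_centered : \int[mu]_x g x = 0.

Definition field_sum (h : n.-tuple T) : R := \sum_(i in S) g (tnth h i).

Lemma bounded_measurable_tnth (f : T -> R) (i : 'I_n) : bounded_measurable f ->
  bounded_measurable (fun h : n.-tuple T => f (tnth h i)).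
Proof. by move=> bf; apply: bounded_measurable_comp bf; exact: measurable_tnth. Qed.

Lemma bounded_measurable_field_sum : bounded_measurable field_sum.
Proof.
by apply: bounded_measurable_sum => i; exact: bounded_measurable_tnth.
Qed.

Lemma field_sum_mgf (lam : R) :
  \int[iid_law mu n]_h expR (lam * field_sum h)
  <= expR (2 * lam ^+ 2 * L ^+ 2 * #|S|%:R).
Proof.
have bexp : bounded_measurable (fun x => expR (lam * g x)).
  by apply: bounded_measurable_expR; apply: bounded_measurableM.
pose f i : T -> R := if i \in S then (fun x => expR (lam * g x)) else (fun=> 1).
have bf i : bounded_measurable (f i) by rewrite /f; case: ifP.
have -> : \int[iid_law mu n]_h expR (lam * field_sum h)
    = \int[iid_law mu n]_h \prod_(i < n) f i (tnth h i).
  apply: eq_Rintegral => h _; rewrite /field_sum mulr_sumr expR_sum big_mkcond/=.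
  by apply: eq_bigr => i _; rewrite /f; case: (i \in S).
rewrite mean_iid_prod//.
have one : \int[mu]_x expR (lam * g x) <= expR (2 * lam ^+ 2 * L ^+ 2).
  apply: (@le_trans _ _ (\int[mu]_x (lam * g x + expR (2 * lam ^+ 2 * L ^+ 2)))).
    apply: mean_le => // [|x].
      by apply: bounded_measurableD => //; exact: bounded_measurableM.
    apply: le_trans (expR_le_addr_sqr _) _; rewrite lerD2l ler_expR.
    have gL : g x ^+ 2 <= L ^+ 2.
      by rewrite -real_normK ?num_real// ler_sqr ?nnegrE//; exact: le_trans (g_le x).
    have -> : 2 * (lam * g x) ^+ 2 = 2 * lam ^+ 2 * g x ^+ 2 by ring.
    by rewrite ler_wpM2l// mulr_ge0 ?sqr_ge0.
  rewrite meanD ?meanZ ?mean_cst ?g_centered ?mulr0 ?add0r//.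
  exact: bounded_measurableM.
apply: (@le_trans _ _ (\prod_(i < n) if i \in S then expR (2 * lam ^+ 2 * L ^+ 2) else 1)).
  apply: ler_prod => i _; rewrite /f; case: ifP => _.
    by rewrite one mean_ge0// => x; exact: expR_ge0.
  by rewrite mean_cst ler01 lexx.
by rewrite -big_mkcond/= prodr_const -expRM_natr.
Qed.

Lemma field_sum_sqr : \int[iid_law mu n]_h field_sum h ^+ 2
  = #|S|%:R * \int[mu]_x (g x ^+ 2).
Proof.
have bg2 : bounded_measurable (fun x => g x * g x) by exact: bounded_measurableM.
have pair i j : \int[iid_law mu n]_h (g (tnth h i) * g (tnth h j))
    = if i == j then \int[mu]_x (g x ^+ 2) else 0.
  case: eqVneq => [<-|ij].
    have := @mean_iid_indep_coord _ _ _ mu n i (fun x => g x ^+ 2) (fun=> 1).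
    rewrite mean_cst mulr1 => <-//.
    by apply: eq_Rintegral => h _; rewrite mulr1.
  rewrite mean_iid_indep_coord ?g_centered ?mul0r//.
    exact: bounded_measurable_tnth.
  by move=> h h' hh'; rewrite hh'// eq_sym.
have bij i j : bounded_measurable (fun h : n.-tuple T => g (tnth h i) * g (tnth h j)).
  by apply: bounded_measurableM; exact: bounded_measurable_tnth.
have -> : \int[iid_law mu n]_h field_sum h ^+ 2
    = \int[iid_law mu n]_h \sum_(i in S) \sum_(j in S) g (tnth h i) * g (tnth h j).
  apply: eq_Rintegral => h _; rewrite expr2 /field_sum mulr_suml.
  by apply: eq_bigr => i _; rewrite mulr_sumr.
rewrite mean_sum; last by move=> i; exact: bounded_measurable_sum.
rewrite mulr_natl -sumr_const; apply: eq_bigr => i iS.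
rewrite mean_sum//; under eq_bigr do rewrite pair.
rewrite (bigD1 i)//= eqxx big1 ?addr0// => j /andP[_ /negbTE ji].
by rewrite eq_sym ji.
Qed.

(** The fourth power is dominated by the exponential series. *)
Lemma field_sum_quartic : L = 1 -> (0 < #|S|)%N ->
  \int[iid_law mu n]_h (field_sum h ^+ 2 / #|S|%:R) ^+ 2 <= 48 * expR 2.
Proof.
move=> L1 S0; pose a := Num.sqrt (#|S|%:R : R).
have k0 : 0 < #|S|%:R :> R by rewrite ltr0n.
have a2 : a ^+ 2 = #|S|%:R by rewrite sqr_sqrtr// ltW.
have a0 : 0 < a by rewrite sqrtr_gt0.
have quart (x : R) : x ^+ 4 <= 24 * (expR x + expR (- x)).
  have h (y : R) : 0 <= y -> y ^+ 4 <= 24 * expR y.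
    move=> y0; have := expR_ge1Dxn 3 y0.
    have -> : 4`! = 24%N by [].
    by move=> ?; rewrite -ler_pdivrMl// mulrC; lra.
  have [x0|/ltW x0] := leP 0 x.
    by apply: le_trans (h _ x0) _; rewrite mulrDr lerDl mulr_ge0 ?expR_ge0.
  have := h (- x); rewrite oppr_ge0 => /(_ x0).
  have -> : (- x) ^+ 4 = x ^+ 4 by ring.
  by move=> /le_trans; apply; rewrite mulrDr lerDr mulr_ge0 ?expR_ge0.
have bS := bounded_measurable_field_sum.
have be lam : bounded_measurable (fun h => expR (lam * field_sum h)).
  by apply: bounded_measurable_expR; exact: bounded_measurableM.
apply: (@le_trans _ _ (\int[iid_law mu n]_h
    (24 * (expR (a^-1 * field_sum h) + expR (- a^-1 * field_sum h))))).
  apply: mean_le => [||h].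
  - under [X in bounded_measurable X]eq_fun do rewrite expr2.
    apply: bounded_measurableM;
    (apply: bounded_measurableM; [|exact: bounded_measurable_cst]);
    under [X in bounded_measurable X]eq_fun do rewrite expr2;
    exact: bounded_measurableM.
  - apply: bounded_measurableM; first exact: bounded_measurable_cst.
    exact: bounded_measurableD.
  - have -> : (field_sum h ^+ 2 / #|S|%:R) ^+ 2 = (a^-1 * field_sum h) ^+ 4.
      by rewrite -a2; field; rewrite gt_eqF.
    by rewrite mulNr; exact: quart.
rewrite meanZ ?meanD//; last exact: bounded_measurableD.
have m := field_sum_mgf a^-1; have m' := field_sum_mgf (- a^-1).
have e : a^-1 ^+ 2 * #|S|%:R = 1 by rewrite -a2; field; rewrite gt_eqF.
have e1 : 2 * a^-1 ^+ 2 * L ^+ 2 * #|S|%:R = 2.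
  by rewrite L1 expr1n mulr1 -mulrA e mulr1.
by rewrite sqrrN e1 in m'; rewrite e1 in m; lra.
Qed.

End iid_sums.

(** * The field and the potential *)

Section field.
Context {R : realType} (mu : probability (measurableTypeR R) R) (theta1 : R).
Hypothesis mu_integrable : mu.-integrable setT (fun h : R => h%:E).
Hypothesis mu_nondegenerate : mu [set (0 : R)] != 1%E.
Hypothesis tanh_centered : \int[mu]_h tanh h = 0.
Local Notation sq := (Num.sqrt theta1).
Local Notation H := (potential mu theta1).

Lemma tanh_eq0 (x : R) : (tanh x == 0) = (x == 0).
Proof.
apply/idP/idP => [|/eqP ->]; last by rewrite /tanh /sinh oppr0 subrr !mul0r.
rewrite /tanh mulf_eq0 invr_eq0 (gt_eqF (cosh_gt0 x)) orbF /sinh.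
rewrite mulf_eq0 invr_eq0 pnatr_eq0 orbF subr_eq0 => /eqP /expR_inj e.
by apply/eqP; lra.
Qed.

(** A field with [tanh h = 0] almost surely is almost surely zero. *)
Lemma tanh_variance_gt0 : 0 < \int[mu]_h (tanh h ^+ 2).
Proof.
have bt := @bounded_measurable_tanh R.
have bt2 : bounded_measurable (fun h : measurableTypeR R => tanh h ^+ 2).
  under [X in bounded_measurable X]eq_fun do rewrite expr2.
  exact: bounded_measurableM.
rewrite lt_neqAle mean_ge0 ?andbT; last by move=> x; exact: sqr_ge0.
apply: contraNneq mu_nondegenerate => e0.
have i0 : (\int[mu]_h `|(tanh h ^+ 2)%:E| = 0)%E.
  under eq_integral => h _ do rewrite gee0_abs ?lee_fin ?sqr_ge0//.
  by rewrite -EFin_mean// -e0.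
have /(ae_eq_integral_abs mu measurableT) [] := i0.
  by apply/measurable_EFinP; case: bt2.
move=> N [mN N0 sub].
have m0 : measurable ([set 0] : set (measurableTypeR R)) by exact: measurable_set1.
have c0 : mu (~` [set (0 : R)]) = 0%E.
  apply: (subset_measure0 _ mN _ N0); first exact: measurableC.
  move=> x x0; apply: sub => /(_ I) /= [] /eqP.
  by rewrite expf_eq0/= tanh_eq0 => /eqP.
have := probability_setC mu m0; rewrite c0 => /esym/eqP.
by rewrite sube_eq ?fin_num_measure// ?add0e eq_sym.
Qed.

Definition remainder (x h : R) : R := cosh_log_ratio theta1 x h - sq * x * tanh h.

Lemma remainder_bounds (x h : R) : 0 < theta1 ->
  0 <= remainder x h <= 8 * theta1 * x ^+ 2.
Proof.
move=> t0; rewrite -mulrA -(sqr_sqrt_theta t0) -exprMn.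
exact: lncosh_shift_bounds.
Qed.

Lemma measurable_lncosh (a : R) :
  measurable_fun setT (fun h : measurableTypeR R => ln (cosh (a + h)) : R).
Proof.
apply: measurableT_comp; first exact: measurable_ln.
apply: measurable_funM => //.
have m1 : measurable_fun setT (fun h : measurableTypeR R => a + h : R).
  exact: measurable_funD.
have mE : measurable_fun setT (expR : measurableTypeR R -> R).
  exact: measurable_expR.
apply: measurable_funD; first exact: measurableT_comp.
by apply: measurableT_comp => //; exact: measurableT_comp.
Qed.

Lemma integrable_lncosh (a : R) :
  mu.-integrable setT (fun h : R => (ln (cosh (a + h)))%:E).
Proof.
apply: (@le_integrable _ _ _ mu _ measurableT _ (fun h : R => (`|a| + `|h|)%:E)).
- by apply/measurable_EFinP; exact: measurable_lncosh.
- move=> h _; rewrite lee_fin ger0_norm ?ln_ge0 ?cosh_ge1//.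
  rewrite [leRHS]ger0_norm ?addr_ge0//; apply: le_trans (ler_normD _ _).
  rewrite -[leRHS]expRK ler_ln ?posrE ?cosh_gt0 ?expR_gt0//.
  rewrite /cosh ler_pdivrMr// mulr_natr mulr2n lerD// ler_expR ?ler_norm//.
  by rewrite -normrN ler_norm.
have -> : (fun h : R => (`|a| + `|h|)%:E) = ((fun=> `|a|%:E) \+ (fun h : R => `|h%:E|))%E.
  by apply/funext => h.
apply: integrableD => //; first exact: finite_measure_integrable_cst.
exact: integrable_abse.
Qed.

Lemma bounded_measurable_remainder (x : R) : 0 < theta1 ->
  bounded_measurable (remainder x : measurableTypeR R -> R).
Proof.
move=> t0; split; last first.
  exists (8 * theta1 * x ^+ 2) => h; have /andP[r0 r1] := remainder_bounds x h t0.
  by rewrite ger0_norm.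
apply: measurable_funB; last first.
  by apply: measurable_funM => //; case: (@bounded_measurable_tanh R).
apply: measurable_funB; first exact: measurable_lncosh.
rewrite (_ : (fun h => _) = (fun h : R => ln (cosh (0 + h)))); last first.
  by apply/funext => h; rewrite add0r.
exact: measurable_lncosh.
Qed.

(** The linear term of the expansion of [ln cosh] disappears in the mean, so
    only the quadratic term and the increment of the potential are left. *)
Lemma mean_remainder (x : R) : 0 < theta1 ->
  \int[mu]_h remainder x h = x ^+ 2 / 2 - (H x - H 0).
Proof.
move=> t0.
have bt : bounded_measurable (fun h : measurableTypeR R => sq * x * tanh h).
  by apply: bounded_measurableM => //; exact: bounded_measurable_tanh.
have := meanD mu (bounded_measurable_remainder x t0) bt.
rewrite meanZ ?tanh_centered ?mulr0 ?addr0; last exact: bounded_measurable_tanh.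
move=> <-.
rewrite /potential unlock mulr0 expr0n/= mul0r sub0r opprK.
have -> : \int[mu]_h (remainder x h + sq * x * tanh h)
    = \int[mu]_h (ln (cosh (sq * x + h)) - ln (cosh (0 + h))).
  by apply: eq_Rintegral => h _; rewrite /remainder subrK add0r.
rewrite RintegralB//; [|exact: integrable_lncosh|exact: integrable_lncosh].
have regroup (u a b : R) : a - b = u - (u - a + b) by ring.
exact: regroup.
Qed.

End field.

(** * The magnetization is not small *)

Section magnetization.
Context {R : realType} (mu : probability (measurableTypeR R) R) (theta1 : R).
Hypothesis mu_integrable : mu.-integrable setT (fun h : R => h%:E).
Hypothesis theta1_gt0 : 0 < theta1.
Hypothesis tanh_centered : \int[mu]_h tanh h = 0.
Local Notation sq := (Num.sqrt theta1).
Local Notation H := (potential mu theta1).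
Hypothesis zero_global_min : forall x, H 0 <= H x.
Context (n : nat) (S : {set 'I_n}).
Hypothesis S_gt0 : (0 < #|S|)%N.
Local Notation k := #|S|.
Local Notation pmf := (planted_pmf mu theta1 S).
Local Notation pcond := (planted_pmf_cond theta1 S).
Local Notation v2 := (\int[mu]_h (tanh h ^+ 2)).

Definition centred_remainder (x h : R) : R :=
  remainder theta1 x h - \int[mu]_y remainder theta1 x y.

Local Notation Y x h := (field_sum S (centred_remainder x) h).
Local Notation A h := (field_sum S tanh h).

Lemma bounded_measurable_centred_remainder x :
  bounded_measurable (centred_remainder x : measurableTypeR R -> R).
Proof.
apply: bounded_measurableB => //; exact: bounded_measurable_remainder.
Qed.

Lemma abs_centred_remainder_le (x h X : R) : `|x| <= X ->
  `|centred_remainder x h| <= 8 * theta1 * X ^+ 2.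
Proof.
move=> xX.
have x2 : x ^+ 2 <= X ^+ 2.
  by rewrite -real_normK ?num_real// ler_sqr ?nnegrE//; exact: le_trans xX.
have b2 : 8 * theta1 * x ^+ 2 <= 8 * theta1 * X ^+ 2.
  by rewrite ler_wpM2l// mulr_ge0// ltW.
have br := bounded_measurable_remainder x theta1_gt0.
have m0 : 0 <= \int[mu]_y remainder theta1 x y.
  by apply: mean_ge0 => y; have /andP[] := remainder_bounds x y theta1_gt0.
have m1 : \int[mu]_y remainder theta1 x y <= 8 * theta1 * x ^+ 2.
  rewrite -[leRHS](mean_cst mu); apply: mean_le => // y.
  by have /andP[] := remainder_bounds x y theta1_gt0.
have /andP[r0 r1] := remainder_bounds x h theta1_gt0.
by rewrite /centred_remainder ler_norml; apply/andP; split; lra.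
Qed.

Lemma mean_centred_remainder x : \int[mu]_h centred_remainder x h = 0.
Proof.
rewrite meanB ?mean_cst ?subrr//; exact: bounded_measurable_remainder.
Qed.

Lemma tilted_energyE (h : n.-tuple R) x :
  tilted_energy theta1 S h x = sq * x * A h + Y x h - k%:R * (H x - H 0).
Proof.
rewrite /tilted_energy /field_sum.
have -> : \sum_(i in S) cosh_log_ratio theta1 x (tnth h i)
    = \sum_(i in S) (sq * x * tanh (tnth h i) + centred_remainder x (tnth h i)
                     + \int[mu]_y remainder theta1 x y).
  by apply: eq_bigr => i _; rewrite /centred_remainder /remainder; ring.
have const (c : R) : \sum_(i in S) c = k%:R * c by rewrite sumr_const mulr_natl.
rewrite 2!big_split/= const -mulr_sumr mean_remainder//.
by field.
Qed.

(** Under a field with [|A| >= a0 sqrt k] the energy [sqrt theta1 x A] wins over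
    the potential at the point [x] of modulus [d X] and of the sign of [A], while
    [|B| < k d X / (2 sqrt theta1)] only uses points [|x| <= d X / 2], which give
    at most half of this energy. *)
Lemma small_magnetization_field (h : n.-tuple R) (X d a0 : R) :
  0 < X -> 0 < d -> 0 < a0 ->
  let N := Num.sqrt k%:R * X in let G := sq * d * a0 in
  (forall x, `|x| = d * X -> k%:R * (H x - H 0) <= G / 8 * N) ->
  k.+1%:R * expR (- (G / 4 * N)) <= 2^-1 ->
  (forall j, (j <= k)%N -> `|sq * (2 * j%:R - k%:R) / k%:R| <= d * X ->
     Y (sq * (2 * j%:R - k%:R) / k%:R) h <= G / 16 * N) ->
  - Y (d * X) h <= G / 16 * N -> - Y (- (d * X)) h <= G / 16 * N ->
  a0 ^+ 2 <= A h ^+ 2 / k%:R ->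
  \sum_(s : spins n | `|block_sum S s| < d / (2 * sq) * k%:R * X) pcond h s <= 2^-1.
Proof.
move=> X0 d0 a00 N G hH hD hY hYp hYm hA.
have k0 : 0 < k%:R :> R by rewrite ltr0n.
have sq0 : 0 < sq by rewrite sqrtr_gt0.
have sk0 : 0 < Num.sqrt k%:R :> R by rewrite sqrtr_gt0.
have N0 : 0 < N by rewrite mulr_gt0.
have absA : a0 * Num.sqrt k%:R <= `|A h|.
  rewrite -ler_sqr ?nnegrE ?mulr_ge0 ?(ltW a00) ?(ltW sk0)// exprMn.
  rewrite sqr_sqrtr ?(ltW k0)//.
  by rewrite real_normK ?num_real// -ler_pdivlMr.
apply: le_trans hD.
pose xs := if 0 <= A h then d * X else - (d * X).
have xsA : sq * xs * A h = sq * (d * X) * `|A h|.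
  rewrite /xs; case: ifP => [A0|/negbT]; first by rewrite ger0_norm.
  by rewrite -ltNge => A0; rewrite ltr0_norm//; ring.
have xsn : `|xs| = d * X.
  by rewrite /xs; case: ifP => _; rewrite ?normrN gtr0_norm// mulr_gt0.
have xsY : - Y xs h <= G / 16 * N by rewrite /xs; case: ifP.
have gain : G * N <= sq * (d * X) * `|A h|.
  have -> : G * N = sq * (d * X) * (a0 * Num.sqrt k%:R) by rewrite /G /N; ring.
  by rewrite ler_wpM2l// !mulr_ge0// ltW.
apply: (@small_magnetization_le _ _ theta1_gt0 _ _ S_gt0 h _ _ xs) => j jk jb.
set x := sq * _ / _.
have xX : `|x| <= d * X / 2.
  rewrite /x normrM normfV normrM (gtr0_norm sq0) (gtr0_norm k0) ler_pdivrMr//.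
  rewrite (_ : d * X / 2 * k%:R = sq * (d / (2 * sq) * k%:R * X)).
    by rewrite ler_wpM2l// ltW.
  by field; rewrite gt_eqF.
have dX0 : 0 < d * X by rewrite mulr_gt0.
have xY : Y x h <= G / 16 * N by apply: hY => //; lra.
have xA : sq * x * A h <= sq * (d * X) * `|A h| / 2.
  apply: le_trans (ler_norm _) _.
  rewrite normrM (normrM sq x) (gtr0_norm sq0).
  have -> : sq * (d * X) * `|A h| / 2 = sq * (d * X / 2) * `|A h| by ring.
  by rewrite ler_wpM2r// ler_wpM2l.
rewrite !tilted_energyE xsA.
have Hx : 0 <= k%:R * (H x - H 0) by rewrite mulr_ge0 ?subr_ge0.
have Hs := hH xs xsn.
lra.
Qed.

Lemma magnetization_laplace_le1 (h : n.-tuple R) (v : R) : 0 <= v ->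
  \sum_(s : spins n) pcond h s * expR (- (v * block_sum S s ^+ 2)) <= 1.
Proof.
move=> v0; rewrite -(sum_planted_pmf_cond theta1 S h); apply: ler_sum => s _.
by rewrite ler_piMr ?planted_pmf_cond_ge0// expR_le1 oppr_le0 mulr_ge0 ?sqr_ge0.
Qed.

(** The exceptional fields are removed by a second moment argument in the
    pointwise form [1 >= a (y - t) - a^2 y^2 / 4] for [y = A^2 / k >= t], and by
    exponential Markov bounds for the fluctuations of the remainders. *)
Lemma planted_magnetization_laplace (X d a0 : R) :
  0 < X -> 0 < d -> 0 < a0 -> a0 ^+ 2 = v2 / 2 ->
  let N := Num.sqrt k%:R * X in let G := sq * d * a0 in
  (forall x, `|x| = d * X -> k%:R * (H x - H 0) <= G / 8 * N) ->
  k.+1%:R * expR (- (G / 4 * N)) <= 2^-1 ->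
  \sum_(s : spins n) pmf s * expR (- ((k%:R * X) ^- 2 * block_sum S s ^+ 2))
  <= 1 - (1 - expR (- (d / (2 * sq)) ^+ 2)) / 2
       * (v2 ^+ 2 / (192 * expR 2)
          - k.+3%:R * expR (- ((G / 16) ^+ 2 / (512 * theta1 ^+ 2 * d ^+ 4 * X ^+ 2)))).
Proof.
move=> X0 d0 a00 a0E N G hH hD.
have k0 : 0 < k%:R :> R by rewrite ltr0n.
have sq0 : 0 < sq by rewrite sqrtr_gt0.
have sk0 : 0 < Num.sqrt k%:R :> R by rewrite sqrtr_gt0.
have N0 : 0 < N by rewrite mulr_gt0.
have G0 : 0 < G by rewrite !mulr_gt0.
have v20 : 0 < v2 by have := exprn_gt0 2 a00; lra.
set e := expR (- (d / (2 * sq)) ^+ 2).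
have e1 : 0 <= 1 - e by rewrite subr_ge0 expR_le1 oppr_le0 sqr_ge0.
pose L := 8 * theta1 * (d * X) ^+ 2.
have L0 : 0 < L by rewrite !mulr_gt0// exprn_gt0// mulr_gt0.
pose eps := G / 16 * N.
have eps0 : 0 < eps by rewrite mulr_gt0// divr_gt0.
(* The minimizer of the exponent [2 lam^2 k L^2 - lam eps]. *)
pose lam := eps / (4 * k%:R * L ^+ 2).
have lam0 : 0 < lam by rewrite divr_gt0// !mulr_gt0// exprn_gt0.
pose pt (j : nat) : R := sq * (2 * j%:R - k%:R) / k%:R.
pose errp (x : R) h := expR (lam * Y x h - lam * eps).
pose errm (x : R) h := expR (- lam * Y x h - lam * eps).
pose Err (h : n.-tuple (measurableTypeR R)) : R :=
  \sum_(j < k.+1 | `|pt j| <= d * X) errp (pt j) h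
  + (errm (d * X) h + errm (- (d * X)) h).
pose al := v2 / (48 * expR 2).
have E2 : 0 < expR 2 :> R by exact: expR_gt0.
have al0 : 0 < al by rewrite divr_gt0// mulr_gt0.
pose y (h : n.-tuple (measurableTypeR R)) : R := A h ^+ 2 / k%:R.
pose om (h : n.-tuple (measurableTypeR R)) : R :=
  \sum_(s : spins n) pcond h s * expR (- ((k%:R * X) ^- 2 * block_sum S s ^+ 2)).
pose br h := al * (y h - a0 ^+ 2) - al ^+ 2 / 4 * y h ^+ 2 - Err h.
have ErrM h : 0 <= Err h.
  rewrite addr_ge0//; last by rewrite addr_ge0// expR_ge0.
  by apply: sumr_ge0 => j _; exact: expR_ge0.
have pointwise h : om h <= 1 - (1 - e) / 2 * br h.
  have sqr_le1 : al * (y h - a0 ^+ 2) - al ^+ 2 / 4 * y h ^+ 2 <= 1.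
    have := sqr_ge0 (1 - al * y h / 2); have := exprn_gt0 2 a00.
    rewrite -(ltr_pM2l al0) mulr0 => ? ?; lra.
  have v0 : 0 <= (k%:R * X) ^- 2 by rewrite invr_ge0 sqr_ge0.
  have [br0|br0] := leP (br h) 0.
    apply: le_trans (magnetization_laplace_le1 h v0) _.
    by rewrite lerDl oppr_ge0 mulr_ge0_le0// divr_ge0.
  have Err1 : Err h < 1 by rewrite /br in br0; lra.
  have yt : a0 ^+ 2 <= y h.
    rewrite leNgt; apply: contraTN br0 => yt; rewrite -leNgt /br.
    have h1 : al * (y h - a0 ^+ 2) <= 0 by rewrite pmulr_rle0// subr_le0 ltW.
    have h2 : 0 <= al ^+ 2 / 4 * y h ^+ 2.
      by rewrite mulr_ge0 ?sqr_ge0// divr_ge0// sqr_ge0.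
    by have := ErrM h; lra.
  have small z : expR z < 1 -> z < 0 by rewrite expR_lt1.
  have rho_le : \sum_(s : spins n | `|block_sum S s| < d / (2 * sq) * k%:R * X)
      pcond h s <= 2^-1.
    have Ym : errm (d * X) h + errm (- (d * X)) h < 1.
      apply: le_lt_trans Err1; rewrite /Err lerDr.
      by apply: sumr_ge0 => j _; exact: expR_ge0.
    apply: (small_magnetization_field X0 d0 a00 hH hD) => //.
    - move=> j jk jX; have lt : (j < k.+1)%N by rewrite ltnS.
      have : errp (pt j) h < 1.
        apply: le_lt_trans Err1.
        rewrite /Err (bigD1 (Ordinal lt))//= -addrA lerDl addr_ge0//.
          by apply: sumr_ge0 => i _; exact: expR_ge0.
        by rewrite addr_ge0// expR_ge0.
      by move=> /small; rewrite subr_lt0 ltr_pM2l// => /ltW.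
    - have : errm (d * X) h < 1.
        by apply: le_lt_trans Ym; rewrite lerDl expR_ge0.
      by move=> /small; rewrite subr_lt0 mulNr -mulrN ltr_pM2l// => /ltW.
    - have : errm (- (d * X)) h < 1.
        by apply: le_lt_trans Ym; rewrite lerDr expR_ge0.
      by move=> /small; rewrite subr_lt0 mulNr -mulrN ltr_pM2l// => /ltW.
  have b0 : 0 <= d / (2 * sq) * k%:R * X.
    by rewrite !mulr_ge0 ?(ltW X0)// ltW// divr_gt0// mulr_gt0.
  apply: le_trans (magnetization_laplace_le theta1 S h v0 b0) _.
  have -> : (k%:R * X) ^- 2 * (d / (2 * sq) * k%:R * X) ^+ 2 = (d / (2 * sq)) ^+ 2.
    by field; rewrite !gt_eqF.
  rewrite -/e lerD2l lerN2 -mulrA ler_wpM2l//.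
  have : br h <= 1 by rewrite /br; have := ErrM h; lra.
  by lra.
have bt := @bounded_measurable_tanh R.
have bA : bounded_measurable (fun h : n.-tuple (measurableTypeR R) => A h).
  exact: bounded_measurable_field_sum.
have by_ : bounded_measurable y.
  apply: bounded_measurableM => //.
  under [X in bounded_measurable X]eq_fun do rewrite expr2.
  exact: bounded_measurableM.
have by2 : bounded_measurable (fun h => y h ^+ 2).
  under [X in bounded_measurable X]eq_fun do rewrite expr2.
  exact: bounded_measurableM.
have bY x : bounded_measurable (fun h : n.-tuple (measurableTypeR R) => Y x h).
  exact: bounded_measurable_field_sum (bounded_measurable_centred_remainder x).
have berr c x : bounded_measurable
    (fun h : n.-tuple (measurableTypeR R) => expR (c * Y x h - lam * eps)).
  apply: bounded_measurable_expR; apply: bounded_measurableB => //.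
  exact: bounded_measurableM.
have bsum : bounded_measurable (fun h : n.-tuple (measurableTypeR R) =>
    \sum_(j < k.+1 | `|pt j| <= d * X) errp (pt j) h).
  by apply: bounded_measurable_sum => j; exact: berr.
have bE2 : bounded_measurable (fun h : n.-tuple (measurableTypeR R) =>
    errm (d * X) h + errm (- (d * X)) h).
  by apply: bounded_measurableD; exact: berr.
have bErr : bounded_measurable Err by exact: bounded_measurableD.
have bom : bounded_measurable om.
  apply: bounded_measurable_sum => s; apply: bounded_measurableM => //.
  exact: bounded_measurable_planted_pmf_cond.
pose E0 := expR (- ((G / 16) ^+ 2 / (512 * theta1 ^+ 2 * d ^+ 4 * X ^+ 2))).
have err_mean c x : c ^+ 2 = lam ^+ 2 -> `|x| <= d * X ->
    \int[iid_law mu n]_h expR (c * Y x h - lam * eps) <= E0.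
  move=> c2 xX.
  under eq_Rintegral do rewrite expRD mulrC.
  rewrite meanZ; last first.
    by apply: bounded_measurable_expR; exact: bounded_measurableM.
  have m := @field_sum_mgf _ _ _ mu n S _ L (bounded_measurable_centred_remainder x)
    (fun h => abs_centred_remainder_le h xX) (mean_centred_remainder x) c.
  apply: le_trans (ler_wpM2l (expR_ge0 _) m) _.
  rewrite -expRD ler_expR le_eqVlt; apply/orP; left; apply/eqP.
  rewrite c2 /lam /eps /L /N.
  have skE : Num.sqrt k%:R ^+ 2 = k%:R :> R by rewrite sqr_sqrtr// ltW.
  move: sk0 skE; set a := Num.sqrt k%:R => a_gt0 <-.
  by field; rewrite !gt_eqF.
have meanErr : \int[iid_law mu n]_h Err h <= k.+3%:R * E0.
  rewrite meanD// meanD; [|exact: berr|exact: berr].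
  rewrite mean_sum; last by move=> j; exact: berr.
  have dX : `|d * X| <= d * X by rewrite gtr0_norm// mulr_gt0.
  have m1 : \int[iid_law mu n]_h errm (d * X) h <= E0.
    by apply: err_mean; rewrite ?sqrrN.
  have m2 : \int[iid_law mu n]_h errm (- (d * X)) h <= E0.
    by apply: err_mean; rewrite ?sqrrN ?normrN.
  have m3 : \sum_(j < k.+1 | `|pt j| <= d * X) \int[iid_law mu n]_h errp (pt j) h
      <= k.+1%:R * E0.
    rewrite natr_mul_sum_ord [leLHS]big_mkcond/=; apply: ler_sum => j _.
    by case: ifP => [jX|_]; [exact: err_mean|exact: expR_ge0].
  have -> : k.+3%:R * E0 = k.+1%:R * E0 + (E0 + E0).
    by rewrite -[k.+3%:R]natr1 -[k.+2%:R]natr1; ring.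
  by apply: lerD m3 _; exact: lerD m1 m2.
have my : \int[iid_law mu n]_h y h = v2.
  rewrite /y; under eq_Rintegral do rewrite mulrC.
  rewrite meanZ; last first.
    under [X in bounded_measurable X]eq_fun do rewrite expr2.
    exact: bounded_measurableM.
  by rewrite (field_sum_sqr S bt tanh_centered) mulKf// gt_eqF.
have my2 : \int[iid_law mu n]_h y h ^+ 2 <= 48 * expR 2.
  exact: (field_sum_quartic bt (@abs_tanh_le1 R) tanh_centered erefl S_gt0).
have bbr : bounded_measurable br.
  apply: bounded_measurableB => //; apply: bounded_measurableB.
    by apply: bounded_measurableM => //; exact: bounded_measurableB.
  exact: bounded_measurableM.
rewrite planted_pmf_mean -/om.
apply: (@le_trans _ _ (\int[iid_law mu n]_h (1 - (1 - e) / 2 * br h))).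
  by apply: mean_le => //; apply: bounded_measurableB => //; exact: bounded_measurableM.
rewrite meanB//; last exact: bounded_measurableM.
rewrite mean_cst meanZ// lerD2l lerN2 ler_wpM2l ?divr_ge0//.
rewrite meanB//; last first.
  apply: bounded_measurableB; last exact: bounded_measurableM.
  by apply: bounded_measurableM => //; exact: bounded_measurableB.
rewrite -/E0 lerB//.
rewrite meanB; [|by apply: bounded_measurableM => //; exact: bounded_measurableB|
  exact: bounded_measurableM].
rewrite !meanZ ?meanB ?mean_cst ?my ?a0E//; last exact: bounded_measurableB.
have -> : v2 ^+ 2 / (192 * expR 2)
    = al * (v2 - v2 / 2) - al ^+ 2 / 4 * (48 * expR 2).
  by rewrite /al; field; rewrite gt_eqF.
by rewrite lerB// ler_wpM2l// divr_ge0// sqr_ge0.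
Qed.

End magnetization.

(** * The union bound *)

Section sample_bounds.
Context {R : realType}.

Lemma phiE (tau k n m : nat) (s : samples n m) (S : {set 'I_n}) :
  phi tau k s S = k%:R `^ (- ((4 * tau%:R - 3) / (2 * tau%:R - 1)))
    * (m%:R^-1 * \sum_(j < m) block_sum S (s j) ^+ 2) :> R.
Proof.
rewrite /phi; congr (_ * _).
rewrite /second_moment_mx -scalemxAr -scalemxAl mxE; congr (_ * _).
rewrite mulmx_sumr mulmx_suml summxE; apply: eq_bigr => j _.
have proj : (indic_col S)^T *m spin_col (s j) = (block_sum S (s j))%:M :> 'M[R]_1.
  apply/matrixP => a b; rewrite !ord1 !mxE /block_sum [RHS]big_mkcond/=.
  by apply: eq_bigr => i _; rewrite !mxE; case: (i \in S); rewrite ?mul1r ?mul0r.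
have proj' : (spin_col (s j))^T *m indic_col S = (block_sum S (s j))%:M :> 'M[R]_1.
  by rewrite -[LHS]trmxK trmx_mul trmxK proj tr_scalar_mx.
by rewrite !mulmxA proj -mulmxA proj' -scalar_mxM mxE eqxx mulr1n expr2.
Qed.

Lemma sum_samples_prod n m (f : spins n -> R) :
  \sum_(s : samples n m) \prod_(j < m) f (s j) = (\sum_(s : spins n) f s) ^+ m.
Proof.
rewrite -(bigA_distr_bigA (fun=> f))/= prodr_const card_ord //.
Qed.

(** The coefficients of [block_sum S' - a * block_sum S] for the overlap
    [a = #|S :&: S'| / #|S|], chosen so that they sum to zero on [S]. *)
Definition overlap_coeff n (S S' : {set 'I_n}) (i : 'I_n) : R :=
  (i \in S')%:R - #|S :&: S'|%:R / #|S|%:R * (i \in S)%:R.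

Section overlap.
Context (n : nat) (S S' : {set 'I_n}).
Hypothesis S_gt0 : (0 < #|S|)%N.
Hypothesis cardS' : #|S'| = #|S|.
Local Notation k := #|S|.
Local Notation a := (#|S :&: S'|%:R / k%:R : R).
Local Notation c := (overlap_coeff S S').

Lemma overlap01 : 0 <= a <= 1.
Proof.
rewrite divr_ge0//= ler_pdivrMr ?ltr0n// mul1r ler_nat.
by apply: subset_leq_card; exact: subsetIl.
Qed.

Lemma overlap_coeff_sum (s : spins n) :
  \sum_(i < n) c i * spin s i = block_sum S' s - a * block_sum S s.
Proof.
rewrite /block_sum mulr_sumr [X in X - _]big_mkcond [X in _ - X]big_mkcond/=.
rewrite -sumrB; apply: eq_bigr => i _; rewrite /overlap_coeff.
by case: (i \in S); case: (i \in S'); rewrite /=; ring.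
Qed.

Lemma overlap_coeff_centred : \sum_(i in S) c i = 0.
Proof.
have k0 : k%:R != 0 :> R by rewrite pnatr_eq0 -lt0n.
rewrite /overlap_coeff sumrB.
have -> : \sum_(i in S) (i \in S')%:R = #|S :&: S'|%:R :> R.
  rewrite -sum1_card natr_sum big_mkcond [RHS]big_mkcond/=; apply: eq_bigr => i _.
  by rewrite inE; case: (i \in S); case: (i \in S').
have -> : \sum_(i in S) a * (i \in S)%:R = a * k%:R.
  rewrite -mulr_sumr; congr (_ * _); rewrite -sum1_card natr_sum.
  by apply: eq_bigr => i ->.
by rewrite divfK// subrr.
Qed.

Lemma overlap_coeff_le1 i : `|c i| <= 1.
Proof.
have /andP[a0 a1] := overlap01; rewrite /overlap_coeff ler_norml.
by case: (i \in S); case: (i \in S'); apply/andP; split; rewrite /=; lra.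
Qed.

Lemma overlap_coeff_norm1 : \sum_(i < n) `|c i| <= 2 * k%:R.
Proof.
have /andP[a0 a1] := overlap01.
apply: (@le_trans _ _ (\sum_(i < n) ((i \in S')%:R + (i \in S)%:R))).
  apply: ler_sum => i _; rewrite /overlap_coeff ler_norml.
  by case: (i \in S); case: (i \in S'); apply/andP; split; rewrite /=; lra.
have cardE (A : {set 'I_n}) : \sum_(i < n) (i \in A)%:R = #|A|%:R :> R.
  by rewrite -sum1_card natr_sum [RHS]big_mkcond; apply: eq_bigr => i _; case: ifP.
by rewrite big_split/= !cardE cardS' -mulr2n mulr_natl.
Qed.

Lemma card_symdiff : #|symdiff S S'|%:R = 2 * (1 - a) * k%:R.
Proof.
have k0 : k%:R != 0 :> R by rewrite pnatr_eq0 -lt0n.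
have e1 := cardsID S' S; have e2 := cardsID S S'.
rewrite finset.setIC in e2; rewrite cardS' in e2.
have -> : (#|symdiff S S'| = #|S :\: S'| + #|S' :\: S|)%N.
  rewrite /symdiff cardsU (_ : _ :&: _ = finset.set0) ?cards0 ?subn0//.
  by apply/setP => i; rewrite !inE; case: (i \in S); case: (i \in S').
have f1 : k%:R = #|S :&: S'|%:R + #|S :\: S'|%:R :> R by rewrite -natrD e1.
have f2 : k%:R = #|S :&: S'|%:R + #|S' :\: S|%:R :> R by rewrite -natrD e2.
have -> : 2 * (1 - a) * k%:R = 2 * (k%:R - #|S :&: S'|%:R) by field.
by rewrite natrD; lra.
Qed.

(** Convexity of the square: [(a B + W)^2 <= a B^2 + W^2 / (1 - a)]. *)
Lemma overlap_fluctuation_ge (delta : R) m (s : samples n m) :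
  0 < delta -> delta * k%:R <= #|symdiff S S'|%:R ->
  \sum_(j < m) block_sum S (s j) ^+ 2 <= \sum_(j < m) block_sum S' (s j) ^+ 2 :> R ->
  (delta / 2) ^+ 2 * \sum_(j < m) block_sum S (s j) ^+ 2
  <= \sum_(j < m) (\sum_(i < n) c i * spin (s j) i) ^+ 2.
Proof.
move=> d0; have k0 : 0 < k%:R :> R by rewrite ltr0n.
rewrite card_symdiff ler_pM2r// => da le.
have /andP[a0 a1] := overlap01.
pose W j := \sum_(i < n) c i * spin (s j) i.
have a1' : 0 < 1 - a by lra.
set B2 := \sum_(j < m) block_sum S (s j) ^+ 2 in le *.
have B20 : 0 <= B2 by apply: sumr_ge0 => j _; exact: sqr_ge0.
have h : (1 - a) * B2 <= (\sum_(j < m) W j ^+ 2) / (1 - a).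
  rewrite mulrBl mul1r lerBlDr; apply: le_trans le _.
  rewrite mulr_suml /B2 mulr_sumr -big_split/=; apply: ler_sum => j _.
  have -> : block_sum S' (s j) = W j + a * block_sum S (s j).
    by rewrite /W overlap_coeff_sum subrK.
  rewrite -subr_ge0.
  have -> : W j ^+ 2 / (1 - a) + a * block_sum S (s j) ^+ 2
      - (W j + a * block_sum S (s j)) ^+ 2
      = a / (1 - a) * (W j - (1 - a) * block_sum S (s j)) ^+ 2.
    move: a1'; set u := a => u1; field; rewrite gt_eqF//.
  by rewrite mulr_ge0 ?sqr_ge0// divr_ge0// ltW.
rewrite ler_pdivlMr// in h.
apply: le_trans h.
have -> : (1 - a) * B2 * (1 - a) = (1 - a) ^+ 2 * B2 by ring.
rewrite ler_wpM2r// ler_sqr ?nnegrE//; lra.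
Qed.

End overlap.

Lemma card_draws_le n k : (#|[pred S : {set 'I_n} | #|S| == k]| <= n ^ k)%N.
Proof.
have -> : #|[pred S : {set 'I_n} | #|S| == k]| = 'C(n, k).
  by rewrite -[in RHS](card_ord n) -card_draws; apply: eq_card => S; rewrite !inE.
have le : (n ^_ k <= n ^ k)%N.
  elim: k => [|k IHk] in n *; first by rewrite ffactn0.
  case: n => [|n]; first by rewrite ffact0n.
  rewrite ffactSS expnS leq_mul2l/=.
  by apply: leq_trans (IHk n) _; case: k {IHk} => // k; rewrite leq_exp2r.
by apply: leq_trans le; rewrite -bin_ffact leq_pmulr// fact_gt0.
Qed.

Context (mu : probability (measurableTypeR R) R) (theta1 : R).
Hypothesis tanh_centered : \int[mu]_h tanh h = 0.

(** Either the average of [B^2] is exceptionally small, or the fluctuation of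
    the block sum over some competitor is exceptionally large; both events are
    controlled by exponential moments of a single sample. *)
Lemma sample_prob_symdiff_le (tau n m : nat) (S : {set 'I_n})
    (Smax : samples n m -> {set 'I_n}) (delta kap beta v : R) :
  (0 < #|S|)%N -> (0 < m)%N -> 0 < delta -> 0 < v ->
  (forall s, phi_argmax (R := R) tau #|S| s (Smax s)) ->
  \sum_(s : spins n) planted_pmf mu theta1 S s * expR (- (v * block_sum S s ^+ 2))
    <= beta ->
  sample_prob mu theta1 S
    [pred s : samples n m | delta * #|S|%:R <= #|symdiff S (Smax s)|%:R]
  <= expR (kap * m%:R) * beta ^+ m
     + (n ^ #|S|)%:R * (expR 1 * (4 * #|S|).+1%:R * #|S|.+1%:R ^+ 2) ^+ m
       * expR (- ((delta / 2) ^+ 2 * (kap * m%:R / v) / (64 * #|S|%:R))).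
Proof.
move=> S0 m0 d0 v0 hmax hbeta.
set k := #|S|.
have k0 : 0 < k%:R :> R by rewrite ltr0n.
have mR0 : 0 < m%:R :> R by rewrite ltr0n.
pose q := planted_pmf mu theta1 S.
have q0 s : 0 <= q s by exact: planted_pmf_ge0.
pose t := (delta / 2) ^+ 2 * (kap * m%:R / v) / (64 * k%:R).
pose W (S' : {set 'I_n}) (s : spins n) : R := \sum_(i < n) overlap_coeff S S' i * spin s i.
pose b1 (s : samples n m) : R := expR (kap * m%:R - v * \sum_(j < m) block_sum S (s j) ^+ 2).
pose b2 (s : samples n m) (S' : {set 'I_n}) : R :=
  expR ((\sum_(j < m) W S' (s j) ^+ 2) / (64 * k%:R) - t).
have bad s : delta * k%:R <= #|symdiff S (Smax s)|%:R ->
    1 <= b1 s + \sum_(S' : {set 'I_n} | #|S'| == k) b2 s S'.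
  move=> bads; have [cardM maxM] := hmax s.
  have le : \sum_(j < m) block_sum S (s j) ^+ 2
      <= \sum_(j < m) block_sum (Smax s) (s j) ^+ 2 :> R.
    have := maxM S erefl; rewrite !phiE ler_pM2l ?powR_gt0// ler_pM2l//.
    by rewrite invr_gt0.
  have fl := overlap_fluctuation_ge S0 cardM d0 bads le.
  set B2 := \sum_(j < m) block_sum S (s j) ^+ 2 in le fl *.
  have ge1 x : 0 <= x -> 1 <= expR x :> R by move=> x0; rewrite -expR0 ler_expR.
  have [small|large] := leP (v * B2) (kap * m%:R).
    rewrite -[leLHS]addr0 lerD//; first by apply: ge1; rewrite subr_ge0.
    by apply: sumr_ge0 => S' _; exact: expR_ge0.
  rewrite (bigD1 (Smax s)) ?cardM//= addrCA -[leLHS]addr0 lerD//; last first.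
    rewrite addr_ge0 ?expR_ge0//; apply: sumr_ge0 => S' _; exact: expR_ge0.
  apply: ge1; rewrite subr_ge0 /t ler_pM2r ?invr_gt0 ?mulr_gt0//.
  apply: le_trans fl; rewrite ler_wpM2l ?sqr_ge0// ler_pdivrMr// (mulrC B2).
  exact: ltW.
have prod0 (s : samples n m) : 0 <= \prod_(j < m) q (s j) by apply: prodr_ge0.
apply: (@le_trans _ _ (\sum_(s : samples n m) (\prod_(j < m) q (s j)) *
    (b1 s + \sum_(S' : {set 'I_n} | #|S'| == k) b2 s S'))).
  rewrite /sample_prob big_mkcond/=; apply: ler_sum => s _.
  case: ifP => [/bad b|_]; first by rewrite -[leLHS]mulr1 ler_wpM2l.
  rewrite mulr_ge0// addr_ge0 ?expR_ge0//; apply: sumr_ge0 => S' _; exact: expR_ge0.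
under eq_bigr do rewrite mulrDr.
rewrite big_split/=; apply: lerD.
  have -> : \sum_(s : samples n m) (\prod_(j < m) q (s j)) * b1 s
      = expR (kap * m%:R) * \sum_(s : samples n m)
          \prod_(j < m) (q (s j) * expR (- (v * block_sum S (s j) ^+ 2))).
    rewrite mulr_sumr; apply: eq_bigr => s _.
    rewrite /b1 expRD mulrCA big_split/= -expR_sum sumrN mulr_sumr.
    by congr (_ * (_ * _)).
  rewrite ler_wpM2l ?expR_ge0//.
  rewrite (sum_samples_prod m (fun s => q s * expR (- (v * block_sum S s ^+ 2)))).
  apply: lerXn2r => //; rewrite nnegrE; last apply: le_trans hbeta;
    by apply: sumr_ge0 => s _; rewrite mulr_ge0 ?expR_ge0.
under eq_bigr do rewrite mulr_sumr.
rewrite exchange_big/=.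
have one (S' : {set 'I_n}) : #|S'| = k ->
    \sum_(s : samples n m) (\prod_(j < m) q (s j)) * b2 s S'
    <= (expR 1 * (4 * k).+1%:R * k.+1%:R ^+ 2) ^+ m * expR (- t).
  move=> cardS'.
  have -> : \sum_(s : samples n m) (\prod_(j < m) q (s j)) * b2 s S'
      = (\sum_(s : samples n m)
          \prod_(j < m) (q (s j) * expR (W S' (s j) ^+ 2 / (64 * k%:R)))) * expR (- t).
    rewrite mulr_suml; apply: eq_bigr => s _.
    by rewrite /b2 expRD mulrA big_split/= -expR_sum mulr_suml.
  rewrite ler_wpM2r ?expR_ge0//.
  rewrite (sum_samples_prod m (fun s => q s * expR (W S' s ^+ 2 / (64 * k%:R)))).
  have nn : 0 <= \sum_(s : spins n) q s * expR (W S' s ^+ 2 / (64 * k%:R)).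
    by apply: sumr_ge0 => s _; rewrite mulr_ge0 ?expR_ge0.
  have le := planted_square_mgf theta1 tanh_centered S0
    (overlap_coeff_centred S' S0) (overlap_coeff_le1 S' S0)
    (overlap_coeff_norm1 S0 cardS').
  by apply: lerXn2r => //; rewrite nnegrE//; exact: le_trans le.
apply: (@le_trans _ _ (\sum_(S' : {set 'I_n} | #|S'| == k)
    (expR 1 * (4 * k).+1%:R * k.+1%:R ^+ 2) ^+ m * expR (- t))).
  by apply: ler_sum => S' /eqP; exact: one.
rewrite sumr_const -[leLHS]mulr_natl -[leRHS]mulrA; apply: ler_wpM2r.
  by rewrite mulr_ge0 ?expR_ge0// exprn_ge0// !mulr_ge0 ?expR_ge0// exprn_ge0.
by rewrite ler_nat; exact: card_draws_le.
Qed.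

End sample_bounds.

(** * Asymptotics *)

Section asymptotics.
Context {R : realType}.
Implicit Types (a c p q : R).

Lemma near_powR_ge c q : 0 < q -> \forall k \near \oo, c <= k%:R `^ q.
Proof.
move=> q0; pose b := expR (ln (Num.max c 1) / q).
have b0 : 0 < b by exact: expR_gt0.
near=> k.
have kb : b <= k%:R.
  apply: (@le_trans _ _ (Num.truncn b).+1%:R); last first.
    by rewrite ler_nat; near: k; exact: nbhs_infty_ge.
  by have /andP[_ /ltW] := truncn_itv (ltW b0).
apply: (@le_trans _ _ (b `^ q)); last first.
  by rewrite ge0_ler_powR ?nnegrE ?(ltW q0) ?(ltW b0).
rewrite -expRM divfK ?gt_eqF// lnK ?posrE ?lt_max ?ltr01 ?orbT//.
by rewrite le_max lexx.
Unshelve. all: by end_near. Qed.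

(** The logarithm of [k] is the multiple [2 / p] of the logarithm of
    [k^(p / 2)]. *)
Lemma near_ln_le_powR a p : 0 < a -> 0 < p ->
  \forall k \near \oo, ln (4 * k + 3)%:R <= a * k%:R `^ p.
Proof.
move=> a0 p0; near=> k.
have k1 : 1 <= k%:R :> R.
  by rewrite ler1n; near: k; exact: nbhs_infty_ge.
have k0 : 0 < k%:R :> R by lra.
have : (7 + 2 / p) / a <= k%:R `^ (p / 2).
  by near: k; apply: near_powR_ge; rewrite divr_gt0.
have : 1 <= k%:R `^ (p / 2) by near: k; apply: near_powR_ge; rewrite divr_gt0.
set y := k%:R `^ (p / 2) => y1 yc.
have y0 : 0 < y by rewrite powR_gt0.
have -> : k%:R `^ p = y ^+ 2.
  rewrite expr2 /y -powRD; last by rewrite (gt_eqF k0) implybT.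
  by congr (_ `^ _); field.
have lny : ln k%:R = 2 / p * ln y by rewrite ln_powR; field; rewrite gt_eqF.
have l7 : ln (4 * k + 3)%:R <= ln 7 + ln k%:R :> R.
  rewrite -lnM ?posrE// ler_ln ?posrE ?ltr0n ?mulr_gt0 ?addn_gt0 ?orbT//.
  by rewrite natrD natrM; lra.
have l7' : ln 7 <= 7 * y :> R.
  by apply: (@le_trans _ _ 7); [exact/ltW/ln_sublinear|rewrite ler_peMr].
have ly : ln k%:R <= 2 / p * y.
  by rewrite lny ler_wpM2l ?divr_ge0 ?(ltW p0)// ltW// ln_sublinear.
have le : (7 + 2 / p) * y <= a * y ^+ 2.
  by rewrite expr2 mulrA ler_pM2r// -ler_pdivrMl// mulrC.
by lra.
Unshelve. all: by end_near. Qed.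

Lemma flat_minimum_le (H : R -> R) tau : flat_minimum H 0 tau ->
  exists2 c, 0 < c & \forall r \near 0^'+, forall x, `|x| <= r ->
    H x - H 0 <= c * `|x| ^+ (2 * tau).
Proof.
move=> [tau2 _ _ /eqO_exP [c c0 near0]].
set D := derive1n _ _ _ in near0.
exists (`|D / ((2 * tau)`!)%:R| + c); first by rewrite ltr_wpDl.
have := near0 => /nbhs_ballP [e /= e0 ball_e].
near=> r => x xr.
have r0 : 0 < r by near: r; exact: nbhs_right_gt.
have x1 : `|x| <= 1 by apply: le_trans xr _; near: r; exact: nbhs_right_le.
have xe : ball (0 : R) e x.
  rewrite /ball/= sub0r normrN; apply: le_lt_trans xr _.
  by near: r; exact: nbhs_right_lt.
have := ball_e _ xe; rewrite subr0 => /(le_trans (ler_norm _)) le.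
have e1 : D / ((2 * tau)`!)%:R * x ^+ (2 * tau)
    <= `|D / ((2 * tau)`!)%:R| * `|x| ^+ (2 * tau).
  by apply: le_trans (ler_norm _) _; rewrite normrM normrX.
have e2 : c * `|x ^+ (2 * tau).+1| <= c * `|x| ^+ (2 * tau).
  by rewrite ler_wpM2l ?(ltW c0)// normrX exprS ler_piMl ?exprn_ge0.
by rewrite mulrDl; lra.
Unshelve. all: by end_near. Qed.

Section scale.
Context (tau k : nat).
Hypothesis tau_ge2 : (2 <= tau)%N.
Hypothesis k_gt0 : (0 < k)%N.
Local Notation g := (1 / (2 * tau%:R - 1) : R).

(** The order of magnitude of [B / k], at which the field term [sqrt k x]
    balances the potential term [k x^(2 tau)]. *)
Definition scale : R := k%:R `^ (- (g / 2)).

Lemma exponent_gt0 : 0 < g.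
Proof.
have : 2 <= tau%:R :> R by rewrite ler_nat.
by move=> ?; rewrite divr_gt0//; lra.
Qed.

Lemma exponent_lt1 : g < 1.
Proof.
have : 2 <= tau%:R :> R by rewrite ler_nat.
by move=> ?; rewrite ltr_pdivrMr; lra.
Qed.

Let kR0 : 0 < k%:R :> R. Proof. by rewrite ltr0n. Qed.

Let powD (p q : R) : k%:R `^ (p + q) = k%:R `^ p * k%:R `^ q.
Proof. by rewrite powRD// (gt_eqF kR0) implybT. Qed.

Let pow1 : k%:R `^ 1 = k%:R :> R. Proof. by rewrite powRr1// ltW. Qed.

Lemma scale_gt0 : 0 < scale. Proof. by rewrite powR_gt0. Qed.

Lemma scale_sqr : scale ^+ 2 = (k%:R `^ g)^-1.
Proof.
have t2 : 2 <= tau%:R :> R by rewrite ler_nat.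
rewrite expr2 -powD -powRN; congr (_ `^ _).
by field; apply/negP => /eqP; lra.
Qed.

Lemma mul_scale_sqr : k%:R * scale ^+ 2 = k%:R `^ (1 - g).
Proof. by rewrite scale_sqr powD pow1 powRN. Qed.

Lemma sqrt_mul_scale : Num.sqrt k%:R * scale = k%:R `^ ((1 - g) / 2).
Proof. by rewrite -powR12_sqrt ?(ltW kR0)// -powD; congr (_ `^ _); ring. Qed.

Lemma mul_scale_pow : k%:R * scale ^+ (2 * tau) = Num.sqrt k%:R * scale.
Proof.
have t2 : 2 <= tau%:R :> R by rewrite ler_nat.
rewrite sqrt_mul_scale -powR_mulrn ?powR_ge0// -powRrM -{1}pow1 -powD natrM.
by congr (_ `^ _); field; apply/negP => /eqP; lra.
Qed.

End scale.
End asymptotics.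

(** * Recovery *)

Section recovery.
Context {R : realType} (mu : probability (measurableTypeR R) R) (theta1 : R).
Context (tau : nat).
Hypothesis mu_integrable : mu.-integrable setT (fun h : R => h%:E).
Hypothesis mu_nondegenerate : mu [set (0 : R)] != 1%E.
Hypothesis theta1_gt0 : 0 < theta1.
Hypothesis tanh_centered : \int[mu]_h tanh h = 0.
Hypothesis zero_global_min :
  forall x : R, potential mu theta1 0 <= potential mu theta1 x.
Hypothesis zero_flat : flat_minimum (potential mu theta1) 0 tau.
Local Notation g := (1 / (2 * tau%:R - 1) : R).

(** At this scale the cost of the potential is at most a fixed multiple of
    [d^(2 tau) N] and the gain from the field a multiple of [d N], for
    [N = k^((1 - g) / 2)]: a small [d] favours the gain, and the error terms are
    exponentially small in powers of [k], against polynomial prefactors. *)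
Lemma magnetization_laplace_scale : exists2 kap : R, 0 < kap &
  \forall k \near \oo, forall n (S : {set 'I_n}), #|S| = k ->
    \sum_(s : spins n) planted_pmf mu theta1 S s
       * expR (- ((k%:R * scale tau k) ^- 2 * block_sum S s ^+ 2))
    <= expR (- (2 * kap)).
Proof.
have tau2 : (2 <= tau)%N by case: zero_flat.
have tau22 : (2 <= 2 * tau)%N by rewrite leq_pmulr// (leq_trans _ tau2).
have g0 := @exponent_gt0 R _ tau2; have g1 := @exponent_lt1 R _ tau2.
have v20 := tanh_variance_gt0 mu_nondegenerate.
set v2 := \int[mu]_h _ in v20.
have [c1 c10 near_flat] := flat_minimum_le zero_flat.
have sq0 : 0 < Num.sqrt theta1 by rewrite sqrtr_gt0.
pose a0 := Num.sqrt (v2 / 2).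
have a00 : 0 < a0 by rewrite sqrtr_gt0 divr_gt0.
have a0E : a0 ^+ 2 = v2 / 2 by rewrite sqr_sqrtr// divr_ge0// ltW.
(* With this [d] the potential at [d X] costs at most an eighth of the gain. *)
pose d := Num.min 1 (Num.sqrt theta1 * a0 / (8 * c1)).
have d0 : 0 < d by rewrite lt_min ltr01 divr_gt0 ?mulr_gt0.
have d1 : d <= 1 by rewrite ge_min lexx.
have dc : c1 * d <= Num.sqrt theta1 * a0 / 8.
  have : d <= Num.sqrt theta1 * a0 / (8 * c1) by rewrite ge_min lexx orbT.
  rewrite ler_pdivlMr ?mulr_gt0// => ?; lra.
clearbody a0 d.
pose G := Num.sqrt theta1 * d * a0.
have G0 : 0 < G by rewrite !mulr_gt0.
pose e := expR (- (d / (2 * Num.sqrt theta1)) ^+ 2) : R.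
have e1 : e < 1.
  by rewrite expR_lt1 oppr_lt0 exprn_gt0// divr_gt0// mulr_gt0.
pose p0 := v2 ^+ 2 / (192 * expR 2).
have num0 N : (0 < N)%N -> 0 < N%:R :> R by rewrite ltr0n.
have p00 : 0 < p0.
  apply: divr_gt0; first exact: exprn_gt0.
  by apply: mulr_gt0; [exact: num0|exact: expR_gt0].
pose c3 := (G / 16) ^+ 2 / (512 * theta1 ^+ 2 * d ^+ 4).
have c30 : 0 < c3.
  apply: divr_gt0; first by apply: exprn_gt0; apply: divr_gt0; [|exact: num0].
  apply: mulr_gt0; last exact: exprn_gt0.
  by apply: mulr_gt0; [exact: num0|exact: exprn_gt0].
exists ((1 - e) * p0 / 8); first by rewrite divr_gt0// mulr_gt0// subr_gt0.
have [r r0 flat_r] : exists2 r, 0 < r & forall x, `|x| <= r ->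
    potential mu theta1 x - potential mu theta1 0 <= c1 * `|x| ^+ (2 * tau).
  have : \forall r \near (0 : R)^'+, 0 < r by exact: nbhs_right_gt.
  by move=> /(filterI near_flat) /filter_ex [r [? ?]]; exists r.
near=> k.
have k0 : (0 < k)%N by near: k; exact: nbhs_infty_ge.
have kR0 : 0 < k%:R :> R by rewrite ltr0n.
have X0 := @scale_gt0 R tau _ k0.
have n0 : d / r <= k%:R `^ (g / 2).
  by near: k; apply: near_powR_ge; rewrite divr_gt0.
have n1 : ln (4 * k + 3)%:R <= G / 4 * k%:R `^ ((1 - g) / 2).
  by near: k; apply: near_ln_le_powR; rewrite divr_gt0// subr_gt0.
have n2 : ln (4 * k + 3)%:R <= c3 / 2 * k%:R `^ g.
  by near: k; apply: near_ln_le_powR; rewrite // divr_gt0.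
have n3 : 2 / p0 <= k%:R.
  rewrite -[leRHS]powRr1 ?(ltW kR0)//.
  by near: k; exact: near_powR_ge.
have l3 : 0 < (4 * k + 3)%:R :> R by rewrite ltr0n addn_gt0 orbT.
have l3E : (4 * k + 3)%:R = 4 * k%:R + 3 :> R by rewrite natrD natrM.
have inv_le (p : R) : 0 < p -> 2 / p <= k%:R -> (4 * k + 3)%:R^-1 <= p / 2.
  move=> p_gt0; rewrite ler_pdivrMr// => kp.
  by rewrite -div1r ler_pdivrMr// l3E; lra.
have expl (x : R) : ln (4 * k + 3)%:R <= x -> expR (- x) <= ((4 * k + 3)%:R)^-1.
  by move=> lx; rewrite expRN lef_pV2 ?posrE ?expR_gt0// -[leLHS]lnK ?posrE// ler_expR.
move=> n S Sk.
have S0 : (0 < #|S|)%N by rewrite Sk.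
have core := planted_magnetization_laplace mu_integrable theta1_gt0
  tanh_centered zero_global_min S0 X0 d0 a00 a0E.
rewrite /= Sk in core.
have hH x : `|x| = d * scale tau k ->
    k%:R * (potential mu theta1 x - potential mu theta1 0)
    <= G / 8 * (Num.sqrt k%:R * scale tau k).
  move=> xE.
  have xr : `|x| <= r.
    by rewrite xE /scale powRN ler_pdivrMr ?powR_gt0// mulrC -ler_pdivrMr.
  apply: le_trans (ler_wpM2l (ltW kR0) (flat_r _ xr)) _.
  rewrite xE exprMn -(mul_scale_pow tau2 k0).
  have -> : k%:R * (c1 * (d ^+ (2 * tau) * scale tau k ^+ (2 * tau)))
      = c1 * d ^+ (2 * tau) * (k%:R * scale tau k ^+ (2 * tau)) by ring.
  rewrite ler_wpM2r//.
    by rewrite mulr_ge0 ?exprn_ge0 ?(ltW X0) ?(ltW kR0).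
  have d2 := ler_wiXn2l (ltW d0) d1 tau22.
  apply: le_trans (ler_wpM2l (ltW c10) d2) _.
  have -> : G / 8 = Num.sqrt theta1 * a0 / 8 * d by rewrite /G; ring.
  by rewrite expr2 mulrA ler_wpM2r ?(ltW d0).
have hD : k.+1%:R * expR (- (G / 4 * (Num.sqrt k%:R * scale tau k))) <= 2^-1.
  rewrite (sqrt_mul_scale _ k0).
  apply: le_trans (ler_wpM2l _ (expl _ n1)) _ => //.
  rewrite ler_pdivrMr// l3E -natr1; lra.
have hE : k.+3%:R * expR (- ((G / 16) ^+ 2
    / (512 * theta1 ^+ 2 * d ^+ 4 * scale tau k ^+ 2))) <= p0 / 2.
  have -> : (G / 16) ^+ 2 / (512 * theta1 ^+ 2 * d ^+ 4 * scale tau k ^+ 2)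
      = c3 / 2 * k%:R `^ g + c3 / 2 * k%:R `^ g.
    rewrite (scale_sqr tau2 k0) /c3.
    have : k%:R `^ g != 0 by rewrite gt_eqF// powR_gt0.
    by move: (k%:R `^ g) => u u0; field; rewrite u0 !gt_eqF.
  rewrite opprD expRD.
  have E2 := expl _ n2; have E20 : 0 <= expR (- (c3 / 2 * k%:R `^ g)) by exact: expR_ge0.
  apply: (@le_trans _ _ (k.+3%:R * ((4 * k + 3)%:R^-1 * (4 * k + 3)%:R^-1))).
    by rewrite ler_wpM2l// ler_pM.
  apply: (@le_trans _ _ ((4 * k + 3)%:R^-1)).
    rewrite mulrA ler_piMl ?invr_ge0 ?(ltW l3)// ler_pdivrMr// mul1r.
    by rewrite ler_nat -[k.+3]addn3 leq_add2r leq_pmull.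
  exact: inv_le.
apply: le_trans (core hH hD) _.
apply: (@le_trans _ _ (1 - 2 * ((1 - e) * p0 / 8))); last exact: expR_ge1Dx.
rewrite lerD2l lerN2 -/v2 -/p0 -/G -/e.
have -> : 2 * ((1 - e) * p0 / 8) = (1 - e) / 2 * (p0 / 2) by field.
rewrite ler_wpM2l//; first by rewrite divr_ge0// subr_ge0 ltW.
by lra.
Unshelve. all: by end_near. Qed.


End recovery.

Section union_bound_asymptotics.
Context {R : realType} (tau : nat).
Hypothesis tau_ge2 : (2 <= tau)%N.
Local Notation g := (1 / (2 * tau%:R - 1) : R).

(** With [m k^(1 - g) >= C k ln n] the exponential of order [m k^(1 - g)] beats
    both the number [n^k] of competitors and the polynomial prefactor raised
    to the power [m]. *)
Lemma union_bound_le_harmonic (kap c C : R) : 0 < kap -> 0 < c -> C = 4 / c ->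
  \forall k \near \oo, forall n m : nat, (k <= n)%N ->
    C * k%:R `^ g * ln n%:R <= m%:R ->
    (0 < m)%N /\
    expR (kap * m%:R) * expR (- (2 * kap)) ^+ m
    + (n ^ k)%:R * (expR 1 * (4 * k).+1%:R * k.+1%:R ^+ 2) ^+ m
      * expR (- (c * m%:R * (k%:R * scale tau k ^+ 2))) <= 2 * harmonic k.
Proof.
have nat1 j : (j.+1 <= 4 * j + 3)%N by lia.
have nat2 j : ((4 * j).+1 <= 4 * j + 3)%N by lia.
have nat3 j : (2 <= j)%N -> (j.+1 <= j ^ 2)%N by move=> ?; rewrite -mulnn; nia.
move=> kap0 c0 CE; have g0 := @exponent_gt0 R _ tau_ge2.
have g1 := @exponent_lt1 R _ tau_ge2.
have C0 : 0 < C by rewrite CE divr_gt0.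
have ln2 : 0 < ln 2 :> R by rewrite ln_gt0// ltr1n.
near=> k.
have k2 : (2 <= k)%N by near: k; exact: nbhs_infty_ge.
have k0 : (0 < k)%N by exact: leq_trans k2.
have kR0 : 0 < k%:R :> R by rewrite ltr0n.
have n1 : ln (4 * k + 3)%:R <= kap * C * ln 2 * k%:R `^ g.
  by near: k; apply: near_ln_le_powR => //; rewrite !mulr_gt0.
have n2 : ln (4 * k + 3)%:R <= c / 12 * k%:R `^ (1 - g).
  by near: k; apply: near_ln_le_powR; rewrite ?subr_gt0// divr_gt0.
have n3 : 4 / c <= k%:R `^ (1 - g).
  by near: k; apply: near_powR_ge; rewrite subr_gt0.
move=> n m kn mC.
have n0 : (0 < n)%N by exact: leq_trans kn.
have nR0 : 0 < n%:R :> R by rewrite ltr0n.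
have l2n : ln 2 <= ln n%:R :> R.
  by rewrite ler_ln ?posrE// ler_nat; exact: leq_trans kn.
have kg0 : 0 < k%:R `^ g by rewrite powR_gt0.
have m2 : C * k%:R `^ g * ln 2 <= m%:R.
  by apply: le_trans mC; rewrite ler_wpM2l// mulr_ge0 ?(ltW C0) ?(ltW kg0).
have mR0 : 0 < m%:R :> R by apply: lt_le_trans m2; rewrite !mulr_gt0.
split; first by rewrite -(ltr0n R).
have -> : 2 * harmonic k = k.+1%:R^-1 + k.+1%:R^-1 :> R by rewrite /harmonic/=; ring.
apply: lerD.
  rewrite -expRM_natr -expRD.
  have -> : kap * m%:R + - (2 * kap) * m%:R = - (kap * m%:R) by ring.
  have le : ln (4 * k + 3)%:R <= kap * m%:R.
    apply: le_trans n1 _.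
    have -> : kap * C * ln 2 * k%:R `^ g = kap * (C * k%:R `^ g * ln 2) by ring.
    by rewrite ler_wpM2l// ltW.
  rewrite expRN lef_pV2 ?posrE ?expR_gt0 ?ltr0n//.
  apply: (@le_trans _ _ (4 * k + 3)%:R); first by rewrite ler_nat nat1.
  by rewrite -[leLHS]lnK ?posrE ?ltr0n ?addn_gt0 ?orbT// ler_expR.
rewrite (mul_scale_sqr tau_ge2 k0).
set u := k%:R `^ (1 - g) in n2 n3 *.
have poly : expR 1 * (4 * k).+1%:R * k.+1%:R ^+ 2 <= expR (c / 2 * u) :> R.
  have l3 : 0 < (4 * k + 3)%:R :> R by rewrite ltr0n addn_gt0 orbT.
  apply: (@le_trans _ _ (expR 1 * (4 * k + 3)%:R ^+ 3)).
    rewrite -mulrA ler_wpM2l ?expR_ge0// exprS ler_pM ?exprn_ge0//.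
      by rewrite ler_nat nat2.
    by rewrite ler_sqr ?nnegrE// ler_nat nat1.
  rewrite -[X in _ * X ^+ _]lnK ?posrE// -expRM_natr -expRD ler_expR.
  rewrite ler_pdivrMr// in n3.
  by rewrite mulrC in n3; lra.
have poly0 : 0 <= expR 1 * (4 * k).+1%:R * k.+1%:R ^+ 2 :> R.
  by rewrite !mulr_ge0 ?expR_ge0 ?exprn_ge0.
have polym := lerXn2r m poly0 (expR_ge0 _) poly.
have nk : (n ^ k)%:R = expR (k%:R * ln n%:R) :> R.
  by rewrite natrX expRM_natl lnK.
apply: (@le_trans _ _ (expR (k%:R * ln n%:R) * expR (c / 2 * u) ^+ m
    * expR (- (c * m%:R * u)))).
  by rewrite nk ler_wpM2r ?expR_ge0// ler_wpM2l ?expR_ge0.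
rewrite -expRM_natr -!expRD.
have mu_ge : 4 / c * (k%:R * ln n%:R) <= m%:R * u.
  have u0 : 0 <= u by exact: powR_ge0.
  have := ler_wpM2r u0 mC.
  have -> : C * k%:R `^ g * ln n%:R * u = C * (k%:R `^ g * u) * ln n%:R by ring.
  rewrite /u -powRD; last by rewrite (gt_eqF kR0) implybT.
  by rewrite addrC subrK powRr1 ?(ltW kR0)// CE mulrA.
have exponent : k%:R * ln n%:R + c / 2 * u * m%:R - c * m%:R * u <= - (k%:R * ln n%:R).
  have := ler_wpM2l (ltW c0) mu_ge.
  have -> : c * (4 / c * (k%:R * ln n%:R)) = 4 * (k%:R * ln n%:R).
    by field; rewrite gt_eqF.
  by move=> ?; lra.
apply: (@le_trans _ _ (expR (- (k%:R * ln n%:R)))); first by rewrite ler_expR.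
rewrite expRN lef_pV2 ?posrE ?expR_gt0 ?ltr0n// -nk ler_nat.
apply: (@leq_trans (k ^ 2)%N); first exact: nat3.
by apply: (@leq_trans (n ^ 2)%N); [rewrite leq_exp2r|rewrite leq_pexp2l].
Unshelve. all: by end_near. Qed.

End union_bound_asymptotics.

Theorem corollary3p7p1 (R : realType) (mu : probability (measurableTypeR R) R)
    (theta1 : R) (tau : nat)
    (mu_integrable : mu.-integrable setT (fun h : R => h%:E))
    (mu_nondegenerate : mu [set (0 : R)] != 1%E)
    (theta1_gt0 : 0 < theta1)
    (tanh_centered : ('E_mu[fun h : R => tanh h] = 0)%E)
    (theta1_critical : theta1 = 1 / fine ('E_mu[fun h : R => (sech h ^+ 2)%R])%E)
    (zero_global_min :
       forall x : R, potential mu theta1 0 <= potential mu theta1 x)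
    (zero_flat : flat_minimum (potential mu theta1) 0 tau)
    (delta : R) (delta_gt0 : 0 < delta) :
  exists2 C : R, 0 < C &
    forall (n m : nat -> nat) (S : forall k, {set 'I_(n k)})
      (Smax : forall k, samples (n k) (m k) -> {set 'I_(n k)}),
    (forall k, (k <= n k)%N) ->
    (fun k => k%:R : R) =o_\oo
      (fun k => (n k)%:R `^ ((4 * tau%:R - 2) / (8 * tau%:R - 5)) : R) ->
    (forall k, #|S k| = k) ->
    (forall k, C * k%:R `^ (1 / (2 * tau%:R - 1)) * ln (n k)%:R
               <= (m k)%:R) ->
    (forall k (s : samples (n k) (m k)),
       phi_argmax (R := R) tau k s (Smax k s)) ->
    sample_prob mu theta1 (S k)
      [pred s : samples (n k) (m k) |
        delta * k%:R <= #|symdiff (S k) (Smax k s)|%:R] @[k --> \oo] --> (0 : R).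
Proof.
have tanh0 : \int[mu]_h tanh h = 0.
  by move: tanh_centered; rewrite unlock => e; rewrite /Rintegral e.
have tau2 : (2 <= tau)%N by case: zero_flat.
have [kap kap0 near_laplace] := magnetization_laplace_scale mu_integrable
  mu_nondegenerate theta1_gt0 tanh0 zero_global_min zero_flat.
pose c := (delta / 2) ^+ 2 * kap / 64.
have c0 : 0 < c by rewrite divr_gt0// mulr_gt0// exprn_gt0// divr_gt0.
exists (4 / c) => [|n m S Smax kn _ Sk mC hmax]; first by rewrite divr_gt0.
have near_union := union_bound_le_harmonic tau2 kap0 c0 erefl.
have bound : \forall k \near \oo, sample_prob mu theta1 (S k)
    [pred s : samples (n k) (m k) |
      delta * k%:R <= #|symdiff (S k) (Smax k s)|%:R] <= 2 * harmonic k.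
  near=> k.
  have k0 : (0 < k)%N by near: k; exact: nbhs_infty_ge.
  have kR0 : 0 < k%:R :> R by rewrite ltr0n.
  have laplace : forall n (S : {set 'I_n}), #|S| = k ->
      \sum_(s : spins n) planted_pmf mu theta1 S s
        * expR (- ((k%:R * scale tau k) ^- 2 * block_sum S s ^+ 2))
      <= expR (- (2 * kap)) by near: k.
  have union : forall n m : nat, (k <= n)%N ->
      4 / c * k%:R `^ (1 / (2 * tau%:R - 1)) * ln n%:R <= m%:R ->
      (0 < m)%N /\
      expR (kap * m%:R) * expR (- (2 * kap)) ^+ m
      + (n ^ k)%:R * (expR 1 * (4 * k).+1%:R * k.+1%:R ^+ 2) ^+ m
        * expR (- (c * m%:R * (k%:R * scale tau k ^+ 2))) <= 2 * harmonic k
    by near: k.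
  have [m0 le] := union _ _ (kn k) (mC k).
  apply: le_trans le.
  have S0 : (0 < #|S k|)%N by rewrite Sk.
  have X0 : 0 < scale tau k :> R by exact: scale_gt0.
  have v0 : 0 < (k%:R * scale tau k) ^- 2 :> R.
    by rewrite invr_gt0 exprn_gt0// mulr_gt0.
  have hmax' s : phi_argmax (R := R) tau #|S k| s (Smax k s) by rewrite Sk.
  have := sample_prob_symdiff_le tanh0 kap S0 m0 delta_gt0 v0 hmax' (laplace _ _ (Sk k)).
  rewrite Sk => /le_trans; apply.
  rewrite lerD2l mulrA le_eqVlt; apply/orP; left; apply/eqP; congr (_ * expR (- _)).
  by rewrite /c; field; rewrite !gt_eqF.
apply: (@squeeze_cvgr _ _ _ _ (fun=> 0) (fun k => 2 * harmonic k)).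
- near=> k; apply/andP; split; last by near: k.
  by apply: sumr_ge0 => s _; apply: prodr_ge0 => j _; exact: planted_pmf_ge0.
- exact: cvg_cst.
- rewrite -[X in _ --> X](mulr0 2); apply: cvgM; first exact: cvg_cst.
  exact: cvg_harmonic.
Unshelve. all: by end_near. Qed.
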